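(* Let $(K,v)$ be a henselian valued field with $v$ non-trivial and let $a\in K^{\mathrm{sep}}\setminus K$. If $(K(a)|K,v)$ is defectless, fix a complete distinguished chain $a_0=a,a_1,\dots,a_n$ of $a$ over $K$. Then $(K(a)|K,v)$ is a tame extension if and only if it is defectless and $\delta_K(a_i)=\omega_K(a_i)$ for all $0\leq i\leq n-1$. In this case, $K(a_i)\supsetneq K(a_{i+1})$ for all $0\leq i\leq n-1$. Moreover, in this case $S_K(a)=\{\delta_K(a),\delta_K(a_1),\dots,\delta_K(a_{n-1})\}$, and hence $\#S_K(a)=\ell(a)$.
   Context: $\overline{K}$ is a fixed algebraic closure of $K$, $K^{\mathrm{sep}}\subseteq\overline K$ the separable-algebraic closure; the unique extension of $v$ to $\overline K$ is again denoted $v$. $vF$ and $Fv$ denote value group and residue field; $\deg_K(b)=[K(b):K]$. The characteristic exponent $p$ is $1$ if $\operatorname{char} Kv=0$ and $p=\operatorname{char}Kv$ otherwise. $S_K(b) := \{ v(b-b^\prime) \mid b^\prime\neq b \text{ is a } K\text{-conjugate of } b\}$ and the Krasner constant is $\omega_K(b):=\max S_K(b)$ (an equality $\delta_K(b)=\omega_K(b)$ presupposes $S_K(b)\neq\emptyset$). Defect: for a finite extension $(E|K,v)$, $[E:K]=(vE:vK)[Ev:Kv]\,d(E|K,v)$, where $d(E|K,v)$ is a power of $p$; the extension is defectless if $d(E|K,v)=1$. Tame: an algebraic extension $(E|K,v)$ is tame if every finite subextension $(E'|K,v)$ satisfies: $(vE':vK)$ is coprime to $p$, $E'v|Kv$ is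 separable, and $d(E'|K,v)=1$. A pair $(b,c)\in\overline K\times\overline K$ is a distinguished pair over $K$ if: $\deg_K(b)>\deg_K(c)$; $\deg_K(z)<\deg_K(b)$ implies $v(b-c)\geq v(b-z)$; and $v(b-c)=v(b-z)$ implies $\deg_K(z)\geq\deg_K(c)$. In this case $\delta_K(b):=v(b-c)=\max\{v(b-z)\mid\deg_K(z)<\deg_K(b)\}$. A complete distinguished chain of $a$ over $K$ is a chain $a_0=a,a_1,\dots,a_n$ in $\overline K$ such that $(a_i,a_{i+1})$ is a distinguished pair over $K$ for all $i$, and $a_n\in K$. Over a henselian field, $a$ admits a complete distinguished chain over $K$ if and only if $(K(a)|K,v)$ is defectless. All complete distinguished chains of $a$ have the same length $n$, and in the defectless case the depth $\ell(a)$ of $a$ over $K$ equals this length $n$. *)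

(* Defs.v *)
From HB Require Import structures.
From mathcomp Require Import all_boot all_order all_algebra.
From mathcomp Require Import generic_quotient ring_quotient separable.
From mathcomp Require Import boolp classical_sets functions cardinality.

Set Implicit Arguments.
Unset Strict Implicit.
Unset Printing Implicit Defensive.

Import Order.TTheory GRing.Theory Num.Theory.
Local Open Scope card_scope.
Local Open Scope classical_set_scope.
Local Open Scope quotient_scope.
Local Open Scope ring_scope.

(* Totally ordered abelian groups, written additively.                       *)

HB.mixin Record isOrderedGroup G of Num.POrderedZmodule G := {
  ogroup_total : total (<=%R : rel G);
  ogroup_leD2r : forall x y z : G, x <= y -> x + z <= y + z }.

#[short(type="ogroupType")]
HB.structure Definition OrderedGroup :=
  {G of Num.POrderedZmodule G & isOrderedGroup G}.

(* The group G with a largest, absorbing element added: None is infinity.    *)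

Definition with_infty (G : Type) := option G.

Section WithInfty.
Variable G : ogroupType.

HB.instance Definition _ := Choice.on (with_infty G).

Definition vzero : with_infty G := Some 0.

Definition vadd (x y : with_infty G) : with_infty G :=
  match x, y with Some a, Some b => Some (a + b) | _, _ => None end.

Definition vle (x y : with_infty G) : bool :=
  match x, y with
  | _, None => true
  | None, Some _ => false
  | Some a, Some b => a <= b
  end.

Fact vle_refl : reflexive vle.
Proof. by move=> [a|] /=. Qed.

Fact vle_anti : antisymmetric vle.
Proof. by move=> [a|] [b|] //= /le_anti ->. Qed.

Fact vle_trans : transitive vle.
Proof. by move=> [a|] [b|] [c|] //=; apply: le_trans. Qed.

Fact vle_total : total vle.
Proof. by move=> [a|] [b|] //=; apply: ogroup_total. Qed.

HB.instance Definition _ :=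
  Order.Le_isPOrder.Build ring_display (with_infty G)
    vle_refl vle_anti vle_trans.

HB.instance Definition _ :=
  Order.POrder_isTotal.Build ring_display (with_infty G) vle_total.

End WithInfty.

(* Krull valuations of arbitrary rank. The value group is the image of the   *)
(* nonzero elements, which may be smaller than G.                            *)

Record valuation (F : fieldType) (G : ogroupType) := Valuation {
  vfun :> F -> with_infty G;
  valE0 : forall x, vfun x = None <-> x = 0;
  valM : forall x y, vfun (x * y) = vadd (vfun x) (vfun y);
  valD : forall x y, Num.min (vfun x) (vfun y) <= vfun (x + y) }.

Definition nontrivial (F : fieldType) (G : ogroupType) (v : valuation F G) :=
  exists2 x, x != 0 & v x != vzero G.

(* Valuations matter only up to equivalence, that is, through their          *)
(* valuation rings: w extends v along iota when the valuation ring of w      *)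
(* meets the smaller field in the valuation ring of v.                       *)

Definition extends (F E : fieldType) (iota : {rmorphism F -> E})
    (G H : ogroupType) (v : valuation F G) (w : valuation E H) :=
  forall x, (vzero _ <= w (iota x)) = (vzero _ <= v x).

Definition equivalent (F : fieldType) (G H : ogroupType)
    (v : valuation F G) (w : valuation F H) :=
  forall x, (vzero _ <= v x) = (vzero _ <= w x).

Definition is_algebraic_closure (K : fieldType) (L : closedFieldType)
    (iota : {rmorphism K -> L}) := forall x, algebraicOver iota x.

Definition henselian (K : fieldType) (G : ogroupType) (v : valuation K G) :=
  forall (L : closedFieldType) (iota : {rmorphism K -> L}),
    is_algebraic_closure iota ->
  forall (G1 G2 : ogroupType) (w1 : valuation L G1) (w2 : valuation L G2),
    extends iota v w1 -> extends iota v w2 -> equivalent w1 w2.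

(* The residue field: the valuation ring modulo its maximal ideal.           *)

Section ResidueField.
Variables (F : fieldType) (G : ogroupType) (v : valuation F G).

Lemma val0 : v 0 = None. Proof. by apply/valE0. Qed.

Lemma val1 : v 1 = vzero G.
Proof.
have := valM v 1 1; rewrite mulr1.
case E: (v 1) => [a|]; last by move/valE0: E => /eqP; rewrite oner_eq0.
by move=> [] /(congr1 (fun y => y - a)); rewrite subrr addrK => <-.
Qed.

Lemma valN1 : v (-1) = vzero G.
Proof.
have := valM v (-1) (-1); rewrite mulrNN mulr1 val1.
case E: (v (-1)) => [a|]; last first.
  by move/valE0: E => /eqP; rewrite oppr_eq0 oner_eq0.
move=> [] Ea; suff -> : a = 0 by [].
case/orP: (ogroup_total 0 a) => a0; apply/eqP; rewrite eq_le ?a0 ?andbT /=.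
  by have := ogroup_leD2r _ _ a a0; rewrite -Ea add0r.
by have := ogroup_leD2r _ _ a a0; rewrite -Ea add0r.
Qed.

Lemma vadd0 (x : with_infty G) : vadd (vzero G) x = x.
Proof. by case: x => [a|] //=; rewrite add0r. Qed.

Lemma valN x : v (- x) = v x.
Proof. by rewrite -mulN1r valM valN1 vadd0. Qed.

Lemma vge0_add (x y : with_infty G) :
  vzero G <= x -> vzero G <= y -> vzero G <= vadd x y.
Proof.
case: x y => [a|] [b|] // a0 b0; apply: (@le_trans _ G b _ _ b0).
by have := ogroup_leD2r _ _ b a0; rewrite add0r.
Qed.

Lemma vgt0_addr (x y : with_infty G) :
  vzero G <= x -> vzero G < y -> vzero G < vadd x y.
Proof.
move=> x0; rewrite !lt_neqAle ![vzero G == _]eq_sym => /andP[yn0 y0].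
rewrite vge0_add // andbT.
case: x y x0 yn0 y0 => [a|] [b|] // a0 bn0 b0; apply: contra bn0 => /eqP[ab0].
apply/eqP; congr Some; apply/eqP; rewrite eq_le; apply/andP; split=> //.
by rewrite -ab0; have := ogroup_leD2r _ _ b a0; rewrite add0r.
Qed.

Definition val_ring : {pred F} := fun x => vzero _ <= v x.

Fact val_ring_subring : subring_closed val_ring.
Proof.
split=> [|x y x0 y0|x y x0 y0]; rewrite unfold_in.
- by rewrite /val_ring val1.
- by apply: le_trans (valD v x (- y)); rewrite valN le_min; apply/andP.
- by rewrite /val_ring valM; apply: vge0_add.
Qed.

HB.instance Definition _ :=
  GRing.isSubringClosed.Build F val_ring val_ring_subring.

Definition val_ringT := {x : F | x \in val_ring}.

HB.instance Definition _ := SubChoice.on val_ringT.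
HB.instance Definition _ := [SubChoice_isSubComNzRing of val_ringT by <:].

Definition max_ideal : {pred val_ringT} := fun x => vzero _ < v (val x).

Fact max_ideal_closed : idealr_closed max_ideal.
Proof.
split; rewrite ?unfold_in /max_ideal.
- by rewrite /= val0.
- by rewrite /= val1 ltxx.
- move=> a x y; rewrite !unfold_in /= => x0 y0.
  apply: lt_le_trans (valD v _ _); rewrite valM lt_min y0 andbT.
  by apply: vgt0_addr => //; exact: (valP a).
Qed.

Fact max_ideal_prime : prime_idealr_closed max_ideal.
Proof.
move=> x y; rewrite !unfold_in /max_ideal /= valM.
have x0 : vzero G <= v (val x) := valP x; have y0 : vzero G <= v (val y) := valP y.
by rewrite !lt_neqAle x0 y0 !andbT => /andP[+ _]; apply: contraNT;
  rewrite negb_or !negbK => /andP[/eqP<- /eqP<-]; rewrite vadd0.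
Qed.

HB.instance Definition _ :=
  isIdealr.Build val_ringT max_ideal max_ideal_closed.
HB.instance Definition _ :=
  isPrimeIdealrClosed.Build val_ringT max_ideal max_ideal_prime.

Definition residue_field := {ideal_quot max_ideal}.

HB.instance Definition _ := GRing.ComNzRing.on residue_field.
HB.instance Definition _ := EqQuotient.on residue_field.

Definition residue (x : F) : residue_field :=
  \pi_residue_field (insubd (0 : val_ringT) x).

Definition residue_inv (q : residue_field) : residue_field :=
  if q == 0 then 0 else residue (val (repr q))^-1.

Fact residue_mulVf q : q != 0 -> residue_inv q * q = 1.
Proof.
move=> qn0; rewrite /residue_inv (negPf qn0) /residue.
set x := repr q; have x_ge0 : vzero G <= v (val x) := valP x.
have vx : v (val x) = vzero G.
  apply/eqP; rewrite eq_sym; apply: contraNT qn0 => vx.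
  rewrite -[q]reprK -/x -(rmorph0 \pi_residue_field) -Quotient.idealrBE subr0 unfold_in.
  by rewrite /max_ideal lt_neqAle vx.
have xn0 : val x != 0 by apply: contra_eq_neq vx => ->; rewrite val0.
have vxV : v (val x)^-1 = vzero G.
  by have := valM v (val x) (val x)^-1; rewrite divff // val1 vx vadd0.
have xVP : (val x)^-1 \in val_ring by rewrite unfold_in /val_ring vxV.
rewrite -[q in LHS]reprK -/x -rmorphM -(rmorph1 \pi_residue_field).
congr (\pi_residue_field _); apply: val_inj.
by rewrite /= /insubd insubT /= mulVf.
Qed.

Fact residue_inv0 : residue_inv 0 = 0.
Proof. by rewrite /residue_inv eqxx. Qed.

HB.instance Definition _ :=
  GRing.ComNzRing_isField.Build residue_field residue_mulVf residue_inv0.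

End ResidueField.

(* Subfields of an ambient field M are represented by the sets of their      *)
(* elements. The functions defined with xget return a default value when     *)
(* the object they describe does not exist.                                  *)

Section Subfields.
Variable M : fieldType.
Implicit Types F E : set M.

Definition is_subfield E := divring_closed (mem E).

Definition adjoin F (b : M) : set M := smallest is_subfield (F `|` [set b]).

Definition is_basis F E (n : nat) (e : 'I_n -> M) :=
  [/\ forall i, E (e i),
      forall x, E x -> exists2 c : 'I_n -> M,
        (forall i, F (c i)) & x = \sum_(i < n) c i * e i
    & forall c : 'I_n -> M, (forall i, F (c i)) ->
        \sum_(i < n) c i * e i = 0 -> forall i, c i = 0].

Definition finite_ext F E :=
  exists (n : nat) (e : 'I_n -> M), is_basis F E e.

Definition degree F E : nat :=
  xget 0%N [set n | exists e : 'I_n -> M, is_basis F E e].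

Definition deg F (b : M) : nat := degree F (adjoin F b).

Definition is_minpoly F (b : M) (q : {poly M}) :=
  [/\ q \is monic, q \is a polyOver (mem F), root q b
    & forall r : {poly M}, r \is a polyOver (mem F) -> r != 0 -> root r b ->
        (size q <= size r)%N].

Definition separable_over F (b : M) :=
  exists2 q, is_minpoly F b q & separable_poly q.

Definition separable_ext F E := forall x, E x -> separable_over F x.

Definition conjugate F (b b' : M) :=
  exists2 q, is_minpoly F b q & root q b'.

End Subfields.

Definition char_exponent (k : fieldType) : nat :=
  xget 1%N [set p | p \in [pchar k]].

Definition coset_index (G : zmodType) (A B : set G) : nat :=
  xget 0%N [set n | [set [set g + h | h in B] | g in A] #= `I_n].

Definition set_max (G : ogroupType) (S : set (with_infty G)) : with_infty G :=
  xget None [set m | S m /\ forall s, S s -> s <= m].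

Section ValuedExtensions.
Variables (L : fieldType) (G : ogroupType) (w : valuation L G).
Implicit Types F E : set L.

Definition value_group E : set G :=
  [set g | exists2 x, E x & w x = Some g].

(* The residue field of E, as a subfield of that of L.                       *)
Definition residues E : set (residue_field w) :=
  [set residue w x | x in [set x | E x /\ vzero G <= w x]].

Definition ram_index F E : nat :=
  coset_index (value_group E) (value_group F).

Definition residue_degree F E : nat := degree (residues F) (residues E).

Definition defect F E : nat :=
  xget 0%N
    [set d | degree F E = (ram_index F E * residue_degree F E * d)%N].

Definition defectless F E := defect F E = 1%N.

(* The residue field of F is a subfield of that of L, so it has the same     *)
(* characteristic exponent.                                                  *)
Definition tame F E := forall E' : set L,
  is_subfield E' -> F `<=` E' -> E' `<=` E -> finite_ext F E' ->
  [/\ coprime (ram_index F E') (char_exponent (residue_field w)),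
      separable_ext (residues F) (residues E')
    & defectless F E'].

Definition krasner_set F (b : L) : set (with_infty G) :=
  [set w (b - b') | b' in [set b' | conjugate F b b' /\ b' <> b]].

(* If b is its only conjugate over F, this is infinity, whereas delta F b is *)
(* finite as soon as b is the first member of a distinguished pair.          *)
Definition omega F (b : L) : with_infty G := set_max (krasner_set F b).

Definition delta F (b : L) : with_infty G :=
  set_max [set w (b - z) | z in [set z | (deg F z < deg F b)%N]].

Definition distinguished_pair F (b c : L) :=
  [/\ (deg F c < deg F b)%N,
      forall z, (deg F z < deg F b)%N -> w (b - z) <= w (b - c)
    & forall z, w (b - c) = w (b - z) -> (deg F c <= deg F z)%N].

Definition complete_distinguished_chain F (a : L) (n : nat) (s : nat -> L) :=
  [/\ s 0%N = a,
      forall i, (i < n)%N -> distinguished_pair F (s i) (s i.+1)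
    & F (s n)].

(* The common length of the complete distinguished chains of a; in the       *)
(* defectless case over a henselian field this is the depth of a.            *)
Definition depth F (a : L) : nat :=
  xget 0%N [set n | exists s, complete_distinguished_chain F a n s].

End ValuedExtensions.

(* Main.v *)
From HB Require Import structures.
Require Import Defs.
From mathcomp Require Import all_boot all_order all_algebra.
From mathcomp Require Import separable ring.
From mathcomp Require Import boolp classical_sets functions cardinality.

Set Implicit Arguments.
Unset Strict Implicit.
Unset Printing Implicit Defensive.

Import Order.TTheory GRing.Theory Num.Theory.
Local Open Scope card_scope.
Local Open Scope classical_set_scope.
Local Open Scope ring_scope.

(* Let [F] be the image of [K]. Henselianity is used only through the fact that
   every [F]-endomorphism of [L] preserves [w]; such endomorphisms are
   transitive on conjugates by Zorn's lemma.

   Suppose [F(b)] is tame and [(b, c)] is a distinguished pair. The fixed field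
   [E'] of the automorphisms moving [b] by at least [omega(b)] contains a best
   approximation [z] of [b], since [F(b) | E'] is defectless. If
   [w(b - z) < omega(b)], the conjugates of [b - z] over [E'] would all be
   congruent to it, which contradicts tameness. With Krasner's lemma this gives
   [delta(b) = omega(b)] and [E' = F(c)], so [F(c)] lies in [F(b)], and an
   automorphism either fixes [c] and moves [b] by [omega(b)] or moves [b] and
   [c] by the same smaller amount. Induction along the chain computes the
   Krasner set.

   Conversely, if [delta = omega] along the chain, adjoin its members from the
   bottom up. At each step [y = a_i - a_(i+1)] has conjugates at distance at most
   [w y], so the residues of their quotients by [y] are pairwise distinct.
   Counting them shows that the ramification index is prime to [p] and that the
   residue extension is generated by one separable element. The top field
   contains [F(a)], and together with defectlessness this gives tameness. *)

(** * Subfields as sets and linear algebra over them *)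

(** [F(c)] cannot be treated directly: at the start [c] is neither known to be separable nor known
    to lie in [F(b)], so tameness of [F(b)] says nothing about it. The field [E'] is instead cut out
    inside [F(b)], where defectlessness passes to both halves of the tower, and it is recognised as
    [F(c)] only at the end, because [c] has minimal degree among the best approximations. The same
    obstacle returns in the converse, where separability is given for [a] alone. Since [a] lies in
    [F(a^q)] for [q] a power of the characteristic, replacing the chain by its [q]-th powers loses
    nothing at the top. The field built there may be larger than [F(a)]; the tower therefore records
    only the ramification index and residue separability, which descend to subextensions, while
    trivial defect comes from the hypothesis on [F(a)]. Separability is also required inside the
    residue field, so it is developed for subsets of an arbitrary field, through [p]-th powers and
    degrees instead of embeddings. *)

Section SubfieldClosure.
Variables (M : fieldType) (F : set M).

Lemma is_subfieldP :
  [/\ F 1, forall x y, F x -> F y -> F (x - y)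
    & forall x y, F x -> F y -> F (x / y)] -> is_subfield F.
Proof.
by case=> F1 FB FV; split=> [|x y|x y]; rewrite !in_setE; [|apply: FB|apply: FV].
Qed.

Hypothesis hF : is_subfield F.

Lemma subf1 : F 1.
Proof. by case: hF; rewrite in_setE. Qed.

Lemma subfB x y : F x -> F y -> F (x - y).
Proof. by case: hF => _ h _; have := h x y; rewrite !in_setE. Qed.

Lemma subfV2 x y : F x -> F y -> F (x / y).
Proof. by case: hF => _ _ h; have := h x y; rewrite !in_setE. Qed.

Lemma subf0 : F 0.
Proof. by rewrite -(subrr 1); apply: subfB; apply: subf1. Qed.

Lemma subfN x : F x -> F (- x).
Proof. by rewrite -sub0r; apply: subfB; apply: subf0. Qed.

Lemma subfD x y : F x -> F y -> F (x + y).
Proof. by move=> Fx Fy; rewrite -[y]opprK; apply/subfB/subfN. Qed.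

Lemma subfV x : F x -> F x^-1.
Proof. by rewrite -[x^-1]mul1r; apply: subfV2; apply: subf1. Qed.

Lemma subfM x y : F x -> F y -> F (x * y).
Proof. by move=> Fx Fy; rewrite -[y]invrK; apply/subfV2/subfV. Qed.

Lemma subfX n x : F x -> F (x ^+ n).
Proof.
by move=> Fx; elim: n => [|n IH]; rewrite ?exprS; [apply: subf1|apply: subfM].
Qed.

Lemma subf_nat n : F n%:R.
Proof.
by elim: n => [|n IH]; [apply: subf0|rewrite -natr1; apply/subfD/subf1].
Qed.

Lemma subf_sum (I : Type) (r : seq I) (P : pred I) (f : I -> M) :
  (forall i, P i -> F (f i)) -> F (\sum_(i <- r | P i) f i).
Proof. by move=> h; apply: big_ind h; [apply: subf0|apply: subfD]. Qed.

End SubfieldClosure.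

Section SubfieldType.
Variables (M : fieldType) (F : set M) (hF : is_subfield F).

(** Indexing the predicate by the proof lets the closure structure be attached to it, so that [sft]
    is a genuine field and matrices and polynomials over [F] become available. *)
Definition sfpred of is_subfield F : {pred M} := mem F.
HB.instance Definition _ := GRing.isDivringClosed.Build M (sfpred hF) hF.
Definition sft := {x : M | x \in sfpred hF}.
HB.instance Definition _ := SubChoice.on sft.
HB.instance Definition _ := [SubChoice_isSubComUnitRing of sft by <:].
HB.instance Definition _ := [SubComUnitRing_isSubIntegralDomain of sft by <:].
HB.instance Definition _ := [SubIntegralDomain_isSubField of sft by <:].

Definition sfv : {rmorphism sft -> M} := \val.

Lemma sfvP (x : sft) : F (sfv x).
Proof. by case: x => x /= hx; move: hx; rewrite /sfpred in_setE. Qed.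

Lemma sfv_ex x : F x -> exists y : sft, sfv y = x.
Proof.
move=> Fx; have hx : x \in sfpred hF by rewrite /sfpred in_setE.
by exists (exist _ x hx).
Qed.

End SubfieldType.

Section LinearAlgebra.
Variable M : fieldType.
Implicit Types F E V : set M.

(** Any finite index type is allowed, unlike in [is_basis]: products index bases of towers, and
    [option] adds a vector to a family. *)
Definition lcomb F (I : finType) (e : I -> M) (x : M) :=
  exists2 c : I -> M, (forall i, F (c i)) & x = \sum_i c i * e i.

Definition indep F (I : finType) (e : I -> M) :=
  forall c : I -> M, (forall i, F (c i)) ->
    \sum_i c i * e i = 0 -> forall i, c i = 0.

Definition fbasis F E (I : finType) (e : I -> M) :=
  [/\ forall i, E (e i), forall x, E x -> lcomb F e x & indep F e].

Lemma indep_reindex F (I J : finType) (h : J -> I) (e : I -> M) :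
  bijective h -> indep F e -> indep F (e \o h).
Proof.
move=> hb; case: (hb) => g gK hK he c Fc c0 j.
rewrite -[j]gK; apply: (he (c \o g)) => [i|]; first exact: Fc.
rewrite (reindex h) /=; last exact: onW_bij.
by rewrite -[RHS]c0; apply: eq_bigr => k _; rewrite /= gK.
Qed.

Lemma lcomb_reindex F (I J : finType) (h : J -> I) (e : I -> M) x :
  bijective h -> lcomb F e x -> lcomb F (e \o h) x.
Proof.
move=> hb [c Fc ->]; exists (c \o h) => [i|]; first exact: Fc.
by rewrite (reindex h) //; apply: onW_bij.
Qed.

Lemma fbasis_is_basis F E (I : finType) (e : I -> M) :
  fbasis F E e -> exists e' : 'I_#|I| -> M, is_basis F E e'.
Proof.
case=> Ee se ie; exists (e \o enum_val); split=> [i|x Ex|].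
- exact: Ee.
- by apply: lcomb_reindex (se x Ex); apply: enum_val_bij.
- by apply: indep_reindex ie; apply: enum_val_bij.
Qed.

Lemma indep_extend F (I : finType) (e : I -> M) (x : M) : is_subfield F ->
  indep F e -> ~ lcomb F e x ->
  indep F (fun o : option I => if o is Some i then e i else x).
Proof.
move=> hF he hx c Fc; rewrite (bigD1 None) //= => c0.
have Es : \sum_(i | i != None) c i * (if i is Some i0 then e i0 else x) =
    \sum_i c (Some i) * e i.
  rewrite (reindex_omap Some id) => [|[]//]; apply: eq_bigl => i /=.
  by rewrite eqxx.
rewrite {}Es in c0.
have cN : c None = 0.
  apply/eqP; apply/negPn/negP => cN; apply: hx.
  exists (fun i => - (c (Some i) / c None)) => [i|].
    by apply: subfN => //; apply: subfV2.
  apply: (mulfI cN); rewrite mulr_sumr.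
  move/eqP: c0; rewrite addr_eq0 => /eqP->.
  rewrite -sumrN; apply: eq_bigr => i _.
  by rewrite mulNr mulrN mulrA [c None * _]mulrC divfK.
rewrite cN mul0r add0r in c0.
by case=> [i|] //; apply: (he (c \o Some)) => // j; apply: Fc.
Qed.

(** The coefficients of [f] in terms of [e] form a matrix over [sft]; with more rows than columns it
    has a nonzero left kernel vector, which is a relation among the [f j]. *)
Lemma dim_le F (I J : finType) (e : I -> M) (f : J -> M) : is_subfield F ->
  (forall j, lcomb F e (f j)) -> indep F f -> (#|J| <= #|I|)%N.
Proof.
move=> hF hlc hf; rewrite leqNgt; apply/negP => ltIJ.
have /choice[A hA] : forall j, exists a : I -> sft hF,
    f j = \sum_i sfv hF (a i) * e i.
  move=> j; have [c Fc ->] := hlc j.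
  have /choice[a ha] : forall i, exists y, sfv hF y = c i.
    by move=> i; apply: sfv_ex.
  by exists a; apply: eq_bigr => i _; rewrite ha.
pose B := \matrix_(j < #|J|, i < #|I|) A (enum_val j) (enum_val i).
have : kermx B != 0.
  rewrite kermx_eq0 -row_leq_rank -ltnNge.
  exact: leq_ltn_trans (rank_leq_col B) ltIJ.
case/rowV0Pn=> u /sub_kermxP uB0 /eqP un0; apply: un0.
apply/rowP => j; rewrite mxE.
pose c j' := sfv hF (u 0 (enum_rank j')).
have /(_ (enum_val j)) : forall j', c j' = 0.
  apply: (hf c) => [j'|]; first exact: sfvP.
  rewrite (eq_bigr (fun j' => \sum_i (c j' * sfv hF (A j' i)) * e i)); last first.
    by move=> j' _; rewrite hA mulr_sumr; apply: eq_bigr => i _; rewrite mulrA.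
  rewrite exchange_big /= big1 // => i _; rewrite -mulr_suml.
  suff -> : \sum_j' c j' * sfv hF (A j' i) = 0 by rewrite mul0r.
  have /rowP/(_ (enum_rank i)) := uB0; rewrite !mxE => /(congr1 (sfv hF)).
  rewrite rmorph0 rmorph_sum => h; rewrite -[RHS]h.
  rewrite (reindex (@enum_val J xpredT)); last exact: (onW_bij _ (enum_val_bij _)).
  by apply: eq_bigr => k _; rewrite /c enum_valK rmorphM mxE enum_rankK.
rewrite /c enum_valK => /eqP; rewrite fmorph_eq0 => /eqP //.
Qed.

Lemma fbasis_card F E (I J : finType) (e : I -> M) (f : J -> M) :
  is_subfield F -> fbasis F E e -> fbasis F E f -> #|I| = #|J|.
Proof.
move=> hF [Ee se ie] [Ef sf if_]; apply/eqP; rewrite eqn_leq.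
apply/andP; split; first by apply: (dim_le hF) ie => i; apply/sf/Ee.
by apply: (dim_le hF) if_ => i; apply/se/Ef.
Qed.

Lemma degreeE F E (I : finType) (e : I -> M) :
  is_subfield F -> fbasis F E e -> degree F E = #|I|.
Proof.
move=> hF he; rewrite /degree.
have [e' he'] := fbasis_is_basis he.
case: xgetP => [n _ [e'' he'']|/(_ #|I|)[]]; last by exists e'.
by rewrite -[LHS]card_ord; apply: fbasis_card he'' he.
Qed.

Lemma finite_extP F E : is_subfield F -> finite_ext F E ->
  exists e : 'I_(degree F E) -> M, fbasis F E e.
Proof.
move=> hF [n [e he]].
by have := degreeE hF (he : fbasis F E e); rewrite card_ord => ->; exists e.
Qed.

Lemma fbasis_finite F E (I : finType) (e : I -> M) :
  fbasis F E e -> finite_ext F E.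
Proof. by move=> /fbasis_is_basis[e' he']; exists #|I|, e'. Qed.

Lemma indep_le_degree F E (I : finType) (e : I -> M) :
  is_subfield F -> finite_ext F E -> (forall i, E (e i)) -> indep F e ->
  (#|I| <= degree F E)%N.
Proof.
move=> hF hE Ee ie; have [b [Eb sb ib]] := finite_extP hF hE.
by rewrite -[degree F E]card_ord; apply: dim_le ie => // i; apply/sb/Ee.
Qed.

Lemma indep_basis F E (I : finType) (e : I -> M) :
  is_subfield F -> finite_ext F E -> (forall i, E (e i)) -> indep F e ->
  (degree F E <= #|I|)%N -> fbasis F E e.
Proof.
move=> hF hE Ee ie le; split=> // x Ex; apply: contrapT => hx.
have := indep_le_degree hF hE _ (indep_extend hF ie hx).
by rewrite card_option ltnNge le /= => h; have: false by apply: h; case.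
Qed.

(** An independent family of maximal length spans [V], since a vector outside its span would extend
    it. *)
Lemma bounded_finite F V N : is_subfield F ->
  (forall n (e : 'I_n -> M), (forall i, V (e i)) -> indep F e -> (n <= N)%N) ->
  finite_ext F V.
Proof.
move=> hF hN.
pose P n := `[< exists2 e : 'I_n -> M, (forall i, V (e i)) & indep F e >].
have P0 : exists n, P n.
  by exists 0%N; apply/asboolP; exists (fun=> 0); [case|move=> ? ? ? []].
have PN n : P n -> (n <= N)%N by case/asboolP => e; apply: hN.
case: (ex_maxnP P0 PN) => n /asboolP[e Ve ie] nmax.
exists n, e; split=> // x Vx; apply: contrapT => hx.
have := indep_extend hF ie hx; set f := fun o => _ => hf.
have : P #|{: option 'I_n}|.
  apply/asboolP; exists (f \o enum_val) => [i|].
    by rewrite /f /=; case: (enum_val i).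
  by apply: indep_reindex hf; apply: enum_val_bij.
by move/nmax; rewrite card_option card_ord ltnn.
Qed.

Lemma finite_sub F E E' : is_subfield F -> finite_ext F E -> E' `<=` E ->
  finite_ext F E'.
Proof.
move=> hF hE sE; apply: (@bounded_finite _ _ (degree F E)) => // n e Ee ie.
by rewrite -[n]card_ord; apply: indep_le_degree ie => // i; apply/sE.
Qed.

Lemma finite_over F E E' : is_subfield F -> is_subfield E' -> F `<=` E' ->
  finite_ext F E -> finite_ext E' E.
Proof.
move=> hF hE' sF hE; apply: (@bounded_finite _ _ (degree F E)) => // n e Ee ie.
rewrite -[n]card_ord; apply: indep_le_degree Ee _ => // c Fc.
by apply: ie => i; apply/sF.
Qed.

Lemma fbasis_tower F E' E (I J : finType) (e : I -> M) (f : J -> M) :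
  is_subfield E' -> is_subfield E -> F `<=` E' -> E' `<=` E ->
  fbasis F E' e -> fbasis E' E f ->
  fbasis F E (fun ij : I * J => e ij.1 * f ij.2).
Proof.
move=> hE' hE sF sE' [Ee se ie] [Ef sf if_].
have sumE (c : I * J -> M) : \sum_ij c ij * (e ij.1 * f ij.2) =
    \sum_j (\sum_i c (i, j) * e i) * f j.
  rewrite (eq_bigr (fun j => \sum_i c (i, j) * (e i * f j))); last first.
    by move=> j _; rewrite mulr_suml; apply: eq_bigr => i _; rewrite mulrA.
  by rewrite exchange_big pair_bigA; apply: eq_bigr => -[].
split=> [[i j]|x /sf[c E'c ->]|c Fc]; first by apply: subfM => //; apply/sE'.
  have /choice[d hd] : forall j, exists d : I -> M,
      (forall i, F (d i)) /\ c j = \sum_i d i * e i.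
    by move=> j; have [d] := se _ (E'c j); exists d.
  exists (fun ij => d ij.2 ij.1) => [ij|]; first by have [] := hd ij.2.
  by rewrite sumE; apply: eq_bigr => j _; have [_ ->] := hd j.
rewrite sumE => /if_ c0 [i j]; apply: (ie (fun i => c (i, j))) => [//|].
apply: c0 => {}j; apply: subf_sum => // {}i _; by apply: subfM => //; apply/sF.
Qed.

Lemma degree_tower F E' E : is_subfield F -> is_subfield E' -> is_subfield E ->
  F `<=` E' -> E' `<=` E -> finite_ext F E ->
  degree F E = (degree F E' * degree E' E)%N.
Proof.
move=> hF hE' hE sF sE' fin.
have [e he] := finite_extP hF (finite_sub hF fin sE').
have [f hf] := finite_extP hE' (finite_over hF hE' sF fin).
by rewrite (degreeE hF (fbasis_tower hE' hE sF sE' he hf)) card_prod !card_ord.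
Qed.

Lemma degree_gt0 F E : is_subfield F -> is_subfield E -> finite_ext F E ->
  (0 < degree F E)%N.
Proof.
move=> hF hE fin; rewrite lt0n; apply/eqP => d0.
have [e [_ se _]] := finite_extP hF fin.
have [c _] := se 1 (subf1 hE); rewrite big1 => [|[i hi] _]; last first.
  by exfalso; rewrite d0 in hi.
by move/eqP; rewrite oner_eq0.
Qed.

Lemma lcomb_sub F E (I : finType) (e : I -> M) (x : M) : is_subfield E ->
  F `<=` E -> (forall i, E (e i)) -> lcomb F e x -> E x.
Proof.
move=> hE sF Ee [c Fc ->]; apply: subf_sum => // i _.
by apply: subfM => //; apply: sF.
Qed.

Lemma degree_eq F E E' : is_subfield F -> is_subfield E' -> F `<=` E' ->
  E' `<=` E -> finite_ext F E ->
  (degree F E <= degree F E')%N -> E = E'.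
Proof.
move=> hF hE' sF sE fin le; apply/seteqP; split=> // x Ex.
have [e [Ee se ie]] := finite_extP hF (finite_sub hF fin sE).
have [|_ sE' _] := indep_basis hF fin (fun i => sE _ (Ee i)) ie.
  by rewrite card_ord.
exact: (lcomb_sub hE' sF Ee (sE' _ Ex)).
Qed.

End LinearAlgebra.

(** * Minimal polynomials and simple extensions *)

Section PolyOver.
Variables (M : fieldType) (F : set M).

Definition pover (q : {poly M}) := forall i, F q`_i.

Hypothesis hF : is_subfield F.

Lemma poverE (q : {poly M}) : (q \is a polyOver (mem F)) <-> pover q.
Proof.
split=> [/(polyOverP (S := sfpred hF)) h i|h]; first by have := h i; rewrite in_setE.
by apply/(polyOverP (S := sfpred hF)) => i; rewrite in_setE.
Qed.

Lemma poverP (q : {poly M}) :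
  pover q <-> exists q' : {poly sft hF}, q = map_poly (sfv hF) q'.
Proof.
split=> [h|[q' ->] i]; last by rewrite coef_map; apply: sfvP.
have /choice[f hf] : forall i, exists y, sfv hF y = q`_i.
  by move=> i; apply: sfv_ex.
exists (\poly_(i < size q) f i); apply/polyP => i.
rewrite coef_map coef_poly; case: ltnP => [_|le]; first exact/esym/hf.
by rewrite nth_default ?rmorph0.
Qed.

Lemma pover_map (q : {poly sft hF}) : pover (map_poly (sfv hF) q).
Proof. by apply/poverP; exists q. Qed.

Lemma poverC c : F c -> pover c%:P.
Proof. by move=> Fc i; rewrite coefC; case: eqP => // _; apply: subf0. Qed.

Lemma poverX : pover 'X.
Proof. by apply/poverP; exists 'X; rewrite map_polyX. Qed.

Lemma poverB p q : pover p -> pover q -> pover (p - q).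
Proof. by move=> hp hq i; rewrite coefB; apply: subfB. Qed.

Lemma poverD p q : pover p -> pover q -> pover (p + q).
Proof. by move=> hp hq i; rewrite coefD; apply: subfD. Qed.

Lemma poverM p q : pover p -> pover q -> pover (p * q).
Proof.
move=> /poverP[p' ->] /poverP[q' ->].
by rewrite -rmorphM; apply: pover_map.
Qed.

Lemma poverXn p n : pover p -> pover (p ^+ n).
Proof.
by move=> /poverP[p' ->]; rewrite -rmorphXn; apply: pover_map.
Qed.

Lemma poverZ c p : F c -> pover p -> pover (c *: p).
Proof. by move=> Fc hp i; rewrite coefZ; apply: subfM. Qed.

Lemma pover_deriv p : pover p -> pover p^`().
Proof. by move=> /poverP[p' ->]; rewrite deriv_map; apply: pover_map. Qed.

Lemma pover_gcd p q : pover p -> pover q -> pover (gcdp p q).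
Proof.
move=> /poverP[p' ->] /poverP[q' ->].
by rewrite -gcdp_map; apply: pover_map.
Qed.

Lemma pover_mod p q : pover p -> pover q -> pover (p %% q).
Proof.
move=> /poverP[p' ->] /poverP[q' ->].
by rewrite -map_modp; apply: pover_map.
Qed.

Lemma pover_div p q : pover p -> pover q -> pover (p %/ q).
Proof.
move=> /poverP[p' ->] /poverP[q' ->].
by rewrite -map_divp; apply: pover_map.
Qed.

Lemma pover_comp p q : pover p -> pover q -> pover (p \Po q).
Proof.
move=> /poverP[p' ->] /poverP[q' ->].
by rewrite -map_comp_poly; apply: pover_map.
Qed.

Definition algebraic_over (b : M) :=
  exists q, [/\ q != 0, pover q & root q b].

Lemma minpoly_ex b : algebraic_over b -> exists q, is_minpoly F b q.
Proof.
move=> [q [q0 Fq qb]].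
pose P n := `[< exists q, [/\ q != 0, pover q, root q b & size q = n] >].
have exP : exists n, P n by exists (size q); apply/asboolP; exists q.
case: (ex_minnP exP) => n /asboolP[r [r0 Fr rb sr]] nmin.
have lr0 : (lead_coef r)^-1 != 0 by rewrite invr_eq0 lead_coef_eq0.
exists ((lead_coef r)^-1 *: r); split.
- by rewrite monicE lead_coefZ mulVf ?lead_coef_eq0.
- by apply/poverE; apply: poverZ => //; apply: subfV => //; apply: Fr.
- by rewrite rootZ.
move=> s /poverE Fs s0 sb; rewrite size_scale // sr; apply: nmin.
by apply/asboolP; exists s.
Qed.

Section MinPoly.
Variables (b : M) (q : {poly M}).
Hypothesis hq : is_minpoly F b q.

Lemma minpoly_monic : q \is monic. Proof. by case: hq. Qed.
Lemma minpoly_neq0 : q != 0. Proof. exact: monic_neq0 minpoly_monic. Qed.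
Lemma minpoly_over : pover q. Proof. by case: hq => _ /poverE. Qed.
Lemma minpoly_root : root q b. Proof. by case: hq. Qed.

Lemma minpoly_alg : algebraic_over b.
Proof. exists q; split; [exact: minpoly_neq0|exact: minpoly_over|exact: minpoly_root]. Qed.

Lemma minpoly_dvd r : pover r -> root r b -> q %| r.
Proof.
move=> Fr rb; rewrite /dvdp; apply/negPn/negP => m0.
case: hq => _ _ _ /(_ (r %% q)) h.
have : (size q <= size (r %% q)%R)%N.
  apply: h => //; first by apply/poverE; apply: pover_mod => //; apply: minpoly_over.
  move: rb; rewrite /root {1}(divp_eq r q) hornerD hornerM.
  by have /rootP -> := minpoly_root; rewrite mulr0 add0r.
by rewrite leqNgt ltn_modp minpoly_neq0.
Qed.

Lemma minpoly_size_gt1 : (1 < size q)%N.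
Proof.
rewrite ltnNge; apply/negP => /size1_polyC qC.
have := minpoly_root; have := minpoly_neq0.
by rewrite qC rootC polyC_eq0 => /negPf ->.
Qed.

(** Let [g] be the gcd. Since [b] is not a root of [r], it is not a root of [g], so it is a root of
    [q / g]; minimality of [q] then forces [g] to be constant. *)
Lemma minpoly_coprime r : pover r -> ~~ root r b -> coprimep r q.
Proof.
move=> Fr rb; rewrite coprimep_sym /coprimep.
have Fg : pover (gcdp q r) by apply: pover_gcd => //; apply: minpoly_over.
have /divpK qE := dvdp_gcdl q r.
have /orP[gb|hb] : root (gcdp q r) b || root (q %/ gcdp q r) b.
- by have := minpoly_root; rewrite -{1}qE rootM orbC.
- by case/negP: rb; move: gb; rewrite -!dvdp_XsubCl => /dvdp_trans; apply; apply: dvdp_gcdr.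
have g0 : gcdp q r != 0 by rewrite gcdp_eq0 negb_and minpoly_neq0.
have := minpoly_dvd (pover_div minpoly_over Fg) hb.
have d0 : q %/ gcdp q r != 0.
  by rewrite divp_eq0 negb_or negb_or g0 minpoly_neq0 -leqNgt dvdp_leq ?dvdp_gcdl ?minpoly_neq0.
move=> /(dvdp_leq d0); rewrite size_divp // leq_subRL; last first.
  by rewrite (leq_trans (leq_pred _)) // dvdp_leq ?dvdp_gcdl ?minpoly_neq0.
have : (0 < size (gcdp q r))%N by rewrite size_poly_gt0.
case: (size (gcdp q r)) => [//|[//|m]] _ /=.
by rewrite addSn ltnNge leq_addl.
Qed.

End MinPoly.

Lemma minpoly_base b : F b -> is_minpoly F b ('X - b%:P).
Proof.
move=> Fb; split; first exact: monicXsubC.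
- by apply/poverE; apply: poverB; [apply: poverX|apply: poverC].
- by rewrite root_XsubC.
move=> r _ r0 rb; rewrite size_XsubC ltnNge; apply/negP => /size1_polyC rC.
by move: rb r0; rewrite rC rootC polyC_eq0 => ->.
Qed.

End PolyOver.

Section Adjoin.
Variable M : fieldType.
Implicit Types F E : set M.

Lemma adjoin_subfield F b : is_subfield (adjoin F b).
Proof.
apply: is_subfieldP; split.
- by move=> S [hS _]; apply: subf1.
- by move=> x y hx hy S hS; apply: subfB; [case: hS|apply: hx|apply: hy].
- by move=> x y hx hy S hS; apply: subfV2; [case: hS|apply: hx|apply: hy].
Qed.

Lemma sub_adjoin F b : F `<=` adjoin F b.
Proof. by move=> x Fx S [_ h]; apply: h; left. Qed.

Lemma mem_adjoin F b : adjoin F b b.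
Proof. by move=> S [_ h]; apply: h; right. Qed.

Lemma adjoin_min F E b : is_subfield E -> F `<=` E -> E b -> adjoin F b `<=` E.
Proof.
by move=> hE sF Eb x; apply; split=> // y [/sF|->].
Qed.

Lemma pover_sub F E q : F `<=` E -> pover F q -> pover E q.
Proof. by move=> sF h i; apply: sF. Qed.

(** The values at [b] of polynomials over [F] already form a subfield: inverses come from a Bezout
    relation with [q]. Reduction modulo [q] gives the size bound. *)
Lemma adjoin_horner F b q x : is_subfield F -> is_minpoly F b q ->
  adjoin F b x -> exists g, [/\ pover F g, (size g < size q)%N & x = g.[b]].
Proof.
move=> hF hq.
pose S := [set x | exists2 g, pover F g & x = g.[b]].
have hS : is_subfield S.
  apply: is_subfieldP; split.
  - exists 1; last by rewrite hornerC.
    by apply: poverC => //; apply: subf1.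
  - move=> _ _ [g Fg ->] [h Fh ->]; exists (g - h); first exact: poverB.
    by rewrite hornerD hornerN.
  move=> _ _ [g Fg ->] [h Fh ->].
  have [hb|hb] := boolP (root h b).
    exists 0; first by apply: poverC => //; apply: subf0.
    by rewrite (rootP hb) invr0 mulr0 horner0.
  have /(poverP hF)[h' hE] := Fh.
  have /(poverP hF)[q' qE] := minpoly_over hF hq.
  have [[u v] /= uv] : exists uv, uv.1 * h' + uv.2 * q' = 1.
    apply/Bezout_eq1_coprimepP; rewrite -(coprimep_map (sfv hF)) -hE -qE.
    exact: (minpoly_coprime hF hq).
  pose um := map_poly (sfv hF) u.
  exists (g * um); first by apply: poverM => //; apply: pover_map.
  have huv : um.[b] * h.[b] = 1.
    have : um * h + map_poly (sfv hF) v * q = 1.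
      by rewrite hE qE -!rmorphM -rmorphD uv rmorph1.
    move/(congr1 (horner^~ b)); rewrite hornerD !hornerM hornerC.
    by rewrite (rootP (minpoly_root hq)) mulr0 addr0.
  rewrite hornerM; congr (_ * _); have hb' : h.[b] != 0 by [].
  by rewrite -[LHS]mul1r -huv -mulrA divff // mulr1.
have sF : F `<=` S.
  by move=> c Fc; exists c%:P; [apply: poverC|rewrite hornerC].
have Sb : S b by exists 'X; [apply: poverX|rewrite hornerX].
move=> /(adjoin_min hS sF Sb)[g Fg ->].
exists (g %% q); split; first by apply: pover_mod => //; apply: (minpoly_over hF hq).
  by rewrite ltn_modp (minpoly_neq0 hq).
by rewrite {1}(divp_eq g q) hornerD hornerM (rootP (minpoly_root hq)) mulr0 add0r.
Qed.

Lemma adjoin_fbasis F b q : is_subfield F -> is_minpoly F b q ->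
  fbasis F (adjoin F b) (fun i : 'I_(size q).-1 => b ^+ i).
Proof.
move=> hF hq; have sq : (size q).-1.+1 = size q.
  by rewrite prednK // ltnW // (minpoly_size_gt1 hq).
split=> [i|x /(adjoin_horner hF hq)[g [Fg sg ->]]|c Fc c0 i].
- by apply: (subfX (adjoin_subfield F b)); apply: mem_adjoin.
- exists (fun i : 'I_(size q).-1 => g`_i) => [i|]; first exact: Fg.
  by rewrite (horner_coef_wide (n := (size q).-1)) // -ltnS sq.
pose g := \poly_(j < (size q).-1) (if insub j is Some k then c k else 0).
have gE (j : 'I_(size q).-1) : g`_j = c j by rewrite coef_poly ltn_ord valK.
have Fg : pover F g.
  move=> j; rewrite coef_poly; case: ifP => _; last exact: subf0.
  by case: insubP => [k _ _|_]; [apply: Fc|apply: subf0].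
have gb : root g b.
  apply/rootP; rewrite (horner_coef_wide _ (size_poly _ _)) -[RHS]c0.
  by apply: eq_bigr => j _; rewrite gE.
have [g0|g0] := eqVneq g 0; first by rewrite -gE g0 coef0.
case: hq => _ _ _ /(_ g (proj2 (poverE hF _) Fg) g0 gb).
by rewrite leqNgt -sq ltnS size_poly.
Qed.

Lemma adjoin_finite F b : is_subfield F -> algebraic_over F b ->
  finite_ext F (adjoin F b).
Proof. by move=> hF /(minpoly_ex hF)[q /(adjoin_fbasis hF)/fbasis_finite]. Qed.

Lemma degE F b q : is_subfield F -> is_minpoly F b q ->
  deg F b = (size q).-1.
Proof.
by move=> hF hq; rewrite /deg (degreeE hF (adjoin_fbasis hF hq)) card_ord.
Qed.

Lemma finite_algebraic F E x : is_subfield F -> is_subfield E ->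
  finite_ext F E -> E x -> algebraic_over F x.
Proof.
move=> hF hE fin Ex; apply: contrapT => nalg.
have := indep_le_degree hF fin (e := fun i : 'I_(degree F E).+1 => x ^+ i).
rewrite card_ord ltnn => h; have: false; last by []; apply: h => [i|c Fc c0].
  exact: (subfX hE).
move=> i; apply/eqP/negPn/negP => ci; apply: nalg.
pose g := \poly_(j < (degree F E).+1) c (inord j).
exists g; split.
- apply: contra_neq ci => g0; have : g`_i = 0 by rewrite g0 coef0.
  by rewrite coef_poly ltn_ord inord_val.
- by move=> j; rewrite coef_poly; case: ifP => _; [apply: Fc|apply: subf0].
apply/rootP; rewrite (horner_coef_wide _ (size_poly _ _)) -[RHS]c0.
by apply: eq_bigr => j _; rewrite coef_poly ltn_ord inord_val.
Qed.

End Adjoin.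

(** * Separability *)

Section Separability.
Variable M : fieldType.
Implicit Types (F E k : set M) (x y : M).

Lemma degree_le F E E' : is_subfield F -> finite_ext F E -> E' `<=` E ->
  (degree F E' <= degree F E)%N.
Proof.
move=> hF fin sE; have [e [Ee _ ie]] := finite_extP hF (finite_sub hF fin sE).
by have := indep_le_degree hF fin (fun i => sE _ (Ee i)) ie; rewrite card_ord.
Qed.

Lemma adjoin_pow F x n : adjoin F x (x ^+ n).
Proof. exact: (subfX (adjoin_subfield F x) n (@mem_adjoin _ F x)). Qed.
Arguments adjoin_pow : clear implicits.

Lemma algebraic_over_sub F E x : F `<=` E -> algebraic_over F x -> algebraic_over E x.
Proof. by move=> sF [q [q0 Fq qx]]; exists q; split=> //; apply: pover_sub Fq. Qed.

Lemma sep_of_poly F x r : is_subfield F -> pover F r -> separable_poly r ->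
  root r x -> separable_over F x.
Proof.
move=> hF Fr sr rx; have [q hq] : exists q, is_minpoly F x q.
  by apply: minpoly_ex => //; exists r; split=> //; apply: separable_poly_neq0.
by exists q => //; apply: dvdp_separable sr; apply: (minpoly_dvd hF hq).
Qed.

Lemma sep_alg F x : is_subfield F -> separable_over F x -> algebraic_over F x.
Proof. by move=> hF [q /(minpoly_alg hF)]. Qed.

Lemma sep_sub F E x : is_subfield F -> is_subfield E -> F `<=` E ->
  separable_over F x -> separable_over E x.
Proof.
move=> hF hE sF [q hq sq]; apply: (@sep_of_poly _ _ q) => //.
  by apply: pover_sub (minpoly_over hF hq).
exact: minpoly_root hq.
Qed.

Lemma sep_base F x : is_subfield F -> F x -> separable_over F x.
Proof.
move=> hF Fx; exists ('X - x%:P); first exact: minpoly_base.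
by have := separable_prod_XsubC [:: x]; rewrite big_seq1.
Qed.

Lemma expXsubC_pchar n x : [pchar M].-nat n ->
  ('X - x%:P) ^+ n = 'X^n - (x ^+ n)%:P :> {poly M}.
Proof.
move=> hn; have hn' : [pchar {poly M}].-nat n by rewrite (eq_pnat _ (pchar_poly M)).
by rewrite exprDn_pchar // exprNn_pchar // -polyC_exp.
Qed.

(** Over [F(x^n)] the minimal polynomial of [x] divides [X^n - x^n = (X - x)^n]; being separable, it
    is [X - x]. *)
Lemma sep_mem_adjoin_pow F x n : is_subfield F -> [pchar M].-nat n ->
  separable_over F x -> adjoin F (x ^+ n) x.
Proof.
move=> hF hn; set E := adjoin F (x ^+ n).
have hE : is_subfield E by apply: adjoin_subfield.
move=> /(sep_sub hF hE (@sub_adjoin _ _ _))[q hq sq].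
have : q %| ('X - x%:P) ^+ n.
  apply: (minpoly_dvd hE hq); last first.
    by rewrite rootE horner_exp hornerXsubC subrr expr0n eqn0Ngt; case/andP: hn => ->.
  rewrite expXsubC_pchar //; apply: poverB => //.
    by apply: poverXn => //; apply: poverX.
  by apply: poverC => //; apply: mem_adjoin.
move=> /dvdp_exp_XsubCP[j _ qE].
have j1 : (j <= 1)%N.
  rewrite leqNgt; apply/negP => j1.
  have s1 : size ('X - x%:P) != 1%N by rewrite size_XsubC.
  by have := separable_nosquare sq j1 s1; rewrite (eqp_dvdr _ qE) dvdpp.
have q0 : root q x := minpoly_root hq.
case: j j1 qE => [|[|//]] _ qE.
  by move: q0; rewrite (eqp_root qE) expr0 rootC oner_eq0.
have {}qE : q = 'X - x%:P.
  by apply/eqP; rewrite -eqp_monic ?monicXsubC ?(minpoly_monic hq).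
have := minpoly_over hE hq 0; rewrite qE coefB coefX coefC sub0r.
by move/(subfN hE); rewrite opprK.
Qed.

(** An inseparable minimal polynomial has zero derivative, hence has the form [h(X^p)]; then [x^p]
    has smaller degree than [x], which contradicts [F(x^p) = F(x)]. *)
Lemma sep_of_mem_adjoin F x : is_subfield F -> algebraic_over F x ->
  (forall p, p \in [pchar M] -> adjoin F (x ^+ p) x) -> separable_over F x.
Proof.
move=> hF /(minpoly_ex hF)[q hq] hx; exists q => //.
have q0 := minpoly_neq0 hq; have q1 := minpoly_size_gt1 hq.
have [d0|d0] := eqVneq q^`() 0; last first.
  have Fd : pover F q^`() by apply: pover_deriv => //; apply: minpoly_over hq.
  rewrite unlock coprimep_sym; apply: (minpoly_coprime hF hq) => //.
  apply/negP => rd; case: hq => _ _ _ /(_ _ (proj2 (poverE hF _) Fd) d0 rd).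
  by rewrite leqNgt lt_size_deriv.
have dq i : (q`_i == 0) || (i%:R == 0 :> M).
  case: i => [|i]; first by rewrite mulr0n eqxx orbT.
  have : q^`()`_i = 0 by rewrite d0 coef0.
  rewrite coef_deriv.
  by move=> /eqP; rewrite -(mulr_natr q`_i.+1) mulf_eq0.
have [p pM] : exists p, p \in [pchar M].
  apply: (@natf0_pchar _ (size q).-1); first by rewrite -ltnS prednK // ltnW.
  have := dq (size q).-1; rewrite -/(lead_coef q) lead_coef_eq0 (negPf q0) /=.
  by [].
have p0 : (0 < p)%N by apply/prime_gt0/(pcharf_prime pM).
pose h := \poly_(j < size q) q`_(j * p).
have qh : q = h \Po 'X^p.
  apply/polyP => i; rewrite coef_comp_poly_Xn //.
  case: ifP => [/dvdnP[j ->]|pi]; last first.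
    by apply/eqP; have := dq i; rewrite -(dvdn_pcharf pM) pi orbF.
  rewrite mulnK // coef_poly; case: ltnP => // le.
  by rewrite nth_default // (leq_trans le) // leq_pmulr.
have Fh : pover F h.
  move=> j; rewrite coef_poly; case: ifP => _; last exact: subf0.
  exact: (minpoly_over hF hq).
have h0 : h != 0 by apply: contra_neq q0 => h0; rewrite qh h0 comp_poly0.
have hr : root h (x ^+ p).
  by have := minpoly_root hq; rewrite /root qh horner_comp hornerXn.
have alg : algebraic_over F (x ^+ p) by exists h.
have [r rm] := minpoly_ex hF alg.
have sr : (size r <= size h)%N.
  by case: rm => _ _ _; apply=> //; apply/(poverE hF).
have := degree_le hF (adjoin_finite hF alg)
  (adjoin_min (adjoin_subfield _ _) (@sub_adjoin _ _ _) (hx _ pM)).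
rewrite -![degree F _]/(deg _ _) (degE hF hq) (degE hF rm).
have := size_comp_poly h 'X^p; rewrite -qh size_polyXn /= => ->.
have r1 := minpoly_size_gt1 rm.
have p1 := prime_gt1 (pcharf_prime pM).
rewrite leqNgt; case/negP.
apply: (@leq_ltn_trans (size h).-1); first by rewrite -!subn1 leq_sub2r.
by rewrite ltn_Pmulr // -ltnS prednK ?(leq_trans _ sr) // ltnW.
Qed.

(** The [k]-span [k E^p] of the [p]-th powers of [E], in inductive form so that substitution of
    coefficients is an induction on sums. *)
Inductive pspan (p : nat) k E : M -> Prop :=
| pspan0 : pspan p k E 0
| pspan_cons c y x : k c -> E y -> pspan p k E x -> pspan p k E (c * y ^+ p + x).

Lemma lcombD k (I : finType) (e : I -> M) x y : is_subfield k ->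
  lcomb k e x -> lcomb k e y -> lcomb k e (x + y).
Proof.
move=> hk [c hc ->] [d hd ->]; exists (fun i => c i + d i) => [i|].
  exact: subfD.
by rewrite -big_split; apply: eq_bigr => i _; rewrite mulrDl.
Qed.

Lemma lcombZ k (I : finType) (e : I -> M) a x : is_subfield k -> k a ->
  lcomb k e x -> lcomb k e (a * x).
Proof.
move=> hk ka [c hc ->]; exists (fun i => a * c i) => [i|]; first exact: subfM.
by rewrite mulr_sumr; apply: eq_bigr => i _; rewrite mulrA.
Qed.

Lemma expr_sum_pchar p (I : finType) (f : I -> M) : p \in [pchar M] ->
  (\sum_i f i) ^+ p = \sum_i f i ^+ p.
Proof.
move=> pM; have hp : [pchar M].-nat p by rewrite pnatE // (pcharf_prime pM).
apply: (big_morph (fun x => x ^+ p)) => [x y|]; first exact: exprDn_pchar.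
by rewrite expr0n eqn0Ngt prime_gt0 ?(pcharf_prime pM).
Qed.

(* Over [k(x^p)] the [p]-th powers of a basis of [E] over [k(x)] span [E], so
   [[E : k(x^p)] <= [E : k(x)]]. *)
Lemma pspan_mem_adjoin p k E x : p \in [pchar M] ->
  is_subfield k -> is_subfield E -> k `<=` E -> finite_ext k E ->
  (forall y, E y -> pspan p k E y) -> E x -> adjoin k (x ^+ p) x.
Proof.
move=> pM hk hE sk fin hps Ex.
set k1 := adjoin k (x ^+ p); set kx := adjoin k x.
have hk1 : is_subfield k1 by apply: adjoin_subfield.
have hkx : is_subfield kx by apply: adjoin_subfield.
have s1x : k1 `<=` kx.
  apply: adjoin_min => //; first exact: sub_adjoin.
  exact: adjoin_pow.
have sxE : kx `<=` E by apply: adjoin_min.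
have skx : k `<=` kx by apply: sub_adjoin.
have sk1 : k `<=` k1 by apply: sub_adjoin.
have finx := finite_over hk hkx skx fin.
have fin1 := finite_over hk hk1 sk1 fin.
have [f [Ef sf _]] := finite_extP hkx finx.
have [q hq] := minpoly_ex hk (finite_algebraic hk hE fin Ex).
have kxp c : kx c -> k1 (c ^+ p).
  move=> /(adjoin_horner hk hq)[g [kg _ ->]].
  rewrite horner_coef expr_sum_pchar //; apply: subf_sum => // i _.
  rewrite exprMn; apply: (subfM hk1).
    by apply: (subfX hk1); apply: sk1.
  by rewrite exprAC; exact: (adjoin_pow k (x ^+ p) i).
have lf y : E y -> lcomb k1 (fun i => f i ^+ p) (y ^+ p).
  move=> /sf[c hc ->]; exists (fun i => c i ^+ p) => [i|]; first exact: kxp.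
  by rewrite expr_sum_pchar //; apply: eq_bigr => i _; rewrite exprMn.
have lf' y : pspan p k E y -> lcomb k1 (fun i => f i ^+ p) y.
  elim=> [|c z x' kc Ez _ IH].
    exists (fun=> 0) => [i|]; first exact: subf0.
    by rewrite big1 // => i _; rewrite mul0r.
  apply: lcombD => //; apply: lcombZ => //; last exact: lf.
  exact: sk1.
have [b [Eb _ ib]] := finite_extP hk1 fin1.
have := dim_le hk1 (fun j => lf' _ (hps _ (Eb j))) ib.
rewrite !card_ord (degree_tower hk1 hkx hE s1x sxE fin1).
have := degree_gt0 hkx hE finx.
move=> d0; rewrite -{2}[degree kx E]mul1n leq_pmul2r // => le1.
have fin1x := finite_sub hk1 fin1 sxE.
have {}le1 : (degree k1 kx <= degree k1 k1)%N.
  by apply: leq_trans le1 _; apply: degree_gt0 => //; apply: finite_sub fin1x s1x.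
have <- : kx = k1 by apply: degree_eq fin1x le1.
exact: mem_adjoin.
Qed.

(* Being spanned by its [p]-th powers over the base is a separability criterion
   that passes through towers and primitive generators by pure linear algebra. *)
Lemma pspan_sep k E : is_subfield k -> is_subfield E -> k `<=` E ->
  finite_ext k E ->
  (forall p, p \in [pchar M] -> forall y, E y -> pspan p k E y) ->
  separable_ext k E.
Proof.
move=> hk hE sk fin hps x Ex; apply: sep_of_mem_adjoin => //.
  exact: finite_algebraic fin Ex.
by move=> p pM; apply: pspan_mem_adjoin Ex => //; apply: hps.
Qed.

Lemma pspanD p k E x y : pspan p k E x -> pspan p k E y -> pspan p k E (x + y).
Proof.
move=> hx hy; elim: hx => [|c z x' kc Ez _ IH]; first by rewrite add0r.
by rewrite -addrA; apply: pspan_cons.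
Qed.

Lemma pspanZ p k E c y x : is_subfield k -> is_subfield E -> k c -> E y ->
  pspan p k E x -> pspan p k E (c * y ^+ p * x).
Proof.
move=> hk hE kc Ey; elim=> [|d z x' kd Ez _ IH]; first by rewrite mulr0; apply: pspan0.
rewrite mulrDr mulrACA -exprMn; apply: pspan_cons => //; exact: subfM.
Qed.

Lemma pspan_sub p k E E' x : E' `<=` E -> pspan p k E' x -> pspan p k E x.
Proof.
move=> sE; elim=> [|c z x' kc Ez _ IH]; [exact: pspan0|].
by apply: pspan_cons => //; apply: sE.
Qed.

Lemma pspan_sum p k E (I : finType) (f : I -> M) :
  (forall i, pspan p k E (f i)) -> pspan p k E (\sum_i f i).
Proof.
by move=> h; apply: big_ind => [|x y|i _]; [apply: pspan0|apply: pspanD|apply: h].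
Qed.

(** A polynomial in [x^p] is a combination of the [p]-th powers [(x^i)^p]. *)
Lemma adjoin_pow_pspan p k x y : p \in [pchar M] -> is_subfield k ->
  algebraic_over k (x ^+ p) -> adjoin k (x ^+ p) y -> pspan p k (adjoin k x) y.
Proof.
move=> pM hk /(minpoly_ex hk)[q hq] /(adjoin_horner hk hq)[g [kg _ ->]].
rewrite horner_coef; apply: pspan_sum => i.
rewrite exprAC -[X in pspan _ _ _ X]addr0; apply: pspan_cons => //; last exact: pspan0.
by apply: adjoin_pow.
Qed.

Lemma algebraic_pow k x n : is_subfield k -> algebraic_over k x ->
  algebraic_over k (x ^+ n).
Proof.
move=> hk alg; apply: (finite_algebraic hk (adjoin_subfield k x)).
  exact: adjoin_finite.
by apply: adjoin_pow.
Qed.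

Lemma sep_pspan p k x : p \in [pchar M] -> is_subfield k ->
  separable_over k x -> pspan p k (adjoin k x) x.
Proof.
move=> pM hk sx; apply: adjoin_pow_pspan => //.
  by apply: algebraic_pow => //; apply: sep_alg.
apply: sep_mem_adjoin_pow => //.
by rewrite pnatE // (pcharf_prime pM).
Qed.

Lemma sep_adjoin k x : is_subfield k -> separable_over k x ->
  separable_ext k (adjoin k x).
Proof.
move=> hk sx; have hE := adjoin_subfield k x.
have alg := sep_alg hk sx.
apply: pspan_sep => //; [exact: sub_adjoin|exact: adjoin_finite|].
move=> p pM y Ey; apply: adjoin_pow_pspan => //; first exact: algebraic_pow.
apply: adjoin_min Ey; first exact: adjoin_subfield.
  exact: sub_adjoin.
apply: sep_mem_adjoin_pow => //.
by rewrite pnatE // (pcharf_prime pM).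
Qed.

(** From [E = k' E^p] and [k' = k k'^p] one gets [E = k E^p] by expanding each coefficient. *)
Lemma sep_trans k k' E : is_subfield k -> is_subfield k' -> is_subfield E ->
  k `<=` k' -> k' `<=` E -> finite_ext k E ->
  separable_ext k k' -> separable_ext k' E -> separable_ext k E.
Proof.
move=> hk hk' hE sk sk' fin sep1 sep2.
apply: pspan_sep => // [x /sk/sk' //|p pM y Ey].
have : pspan p k' E y.
  apply: (pspan_sub _ (sep_pspan pM hk' (sep2 _ Ey))).
  exact: adjoin_min.
elim=> [|c z x k'c Ez _ IH]; first exact: pspan0.
apply: pspanD => //; rewrite mulrC -[z ^+ p]mul1r; apply: pspanZ => //.
  exact: subf1.
apply: (pspan_sub _ (sep_pspan pM hk (sep1 _ k'c))).
apply: adjoin_min => //; last exact: sk'.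
by move=> t /sk/sk'.
Qed.

Lemma sep_pow k x n : is_subfield k -> separable_over k x ->
  separable_over k (x ^+ n).
Proof.
move=> hk sx; apply: (sep_adjoin hk sx).
by apply: adjoin_pow.
Qed.

(** Induction on the degree: if [x] is inseparable, [k(x^p)] is strictly smaller than [k(x)]. *)
Lemma sep_exponent k x : is_subfield k -> algebraic_over k x ->
  exists2 n, [pchar M].-nat n & separable_over k (x ^+ n).
Proof.
move=> hk alg; have [m] := ubnP (deg k x).
elim: m x alg => // m IH x alg; rewrite ltnS => lem.
have [sx|nsx] := pselect (separable_over k x); first by exists 1%N; rewrite ?expr1.
have [p pM hp] : exists2 p, p \in [pchar M] & ~ adjoin k (x ^+ p) x.
  apply: contrapT => h; apply: nsx; apply: sep_of_mem_adjoin => // p pM.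
  by apply: contrapT => h'; apply: h; exists p.
have [] := IH (x ^+ p); first exact: algebraic_pow.
  apply: leq_trans lem; rewrite ltnNge; apply/negP => le; apply: hp.
  have hx := adjoin_subfield k x.
  have <- : adjoin k x = adjoin k (x ^+ p); last exact: mem_adjoin.
  apply: degree_eq (adjoin_finite hk alg) le => //.
  - exact: adjoin_subfield.
  - exact: sub_adjoin.
  apply: adjoin_min => //; first exact: sub_adjoin.
  exact: adjoin_pow.
move=> n hn sn; exists (p * n)%N; last by rewrite exprM.
by rewrite pnatM hn andbT pnatE // (pcharf_prime pM).
Qed.

End Separability.

(** * Extension of embeddings and conjugates *)

(** Additivity together with the trivial fibre over 0 makes the relation single-valued. Zorn's lemma
    produces graphs, and this turns a total one into a morphism. *)
Lemma rmorphism_of_graph (A B : fieldType) (R : A -> B -> Prop) :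
  (forall x, exists y, R x y) -> (forall y, R 0 y -> y = 0) -> R 1 1 ->
  (forall x y x' y', R x y -> R x' y' -> R (x - x') (y - y')) ->
  (forall x y x' y', R x y -> R x' y' -> R (x * x') (y * y')) ->
  exists s : {rmorphism A -> B}, forall x, R x (s x).
Proof.
move=> /choice[f hf] R0 R1 RB RM.
have uf x y : R x y -> f x = y.
  move=> Rxy; apply/eqP; rewrite -subr_eq0; apply/eqP/R0.
  by rewrite -(subrr x); apply: RB.
have fB : zmod_morphism f by move=> x y; apply: uf; apply: RB.
have fM : monoid_morphism f by split=> [|x y]; apply: uf => //; apply: RM.
pose fB' := GRing.isZmodMorphism.Build A B f fB.
pose fM' := GRing.isMonoidMorphism.Build A B f fM.
pose s : {rmorphism A -> B} := HB.pack f fB' fM'.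
by exists s.
Qed.

Section Extension.
Variable L : closedFieldType.

(** The graph of an embedding of a subfield of [L], encoded as a set of pairs so that chains have
    unions. Quotients by [x' = 0] are consistent: then [y' = 0], and both quotients are 0. *)
Definition partial_embedding (R : set (L * L)) :=
  [/\ R (1, 1),
      forall x y x' y', R (x, y) -> R (x', y') -> R (x - x', y - y'),
      forall x y x' y', R (x, y) -> R (x', y') -> R (x / x', y / y')
    & forall y, R (0, y) -> y = 0].

(** The map [g(x)] to [g(y)]. The first two hypotheses say, in terms of polynomials over [D], that
    [q] is the minimal polynomial of [x] up to a scalar. *)
Lemma adjoin_embedding (D : fieldType) (j1 j2 : {rmorphism D -> L})
    (q : {poly D}) (x y : L) :
  (forall g, ~~ root (map_poly j1 g) x -> coprimep g q) ->
  (forall g, root (map_poly j1 g) x -> q %| g) ->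
  root (map_poly j1 q) x -> root (map_poly j2 q) y ->
  partial_embedding
    [set z | exists g, z = ((map_poly j1 g).[x], (map_poly j2 g).[y])].
Proof.
move=> hcop hdvd qx qy; split.
- by exists 1; rewrite !rmorph1 !hornerC.
- by move=> _ _ _ _ [g [-> ->]] [h [-> ->]]; exists (g - h); rewrite !rmorphB !hornerE.
- move=> _ _ _ _ [g [-> ->]] [h [-> ->]].
  have [hx|hx] := boolP (root (map_poly j1 h) x).
    have /dvdpP[u ->] := hdvd _ hx; exists 0.
    by rewrite !rmorphM !hornerM (rootP qx) (rootP qy) !mulr0 !invr0 !mulr0 !rmorph0 !hornerC.
  have /Bezout_eq1_coprimepP[[u v] /= uv] := hcop _ hx.
  have inv (j : {rmorphism D -> L}) z : root (map_poly j q) z ->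
      (map_poly j u).[z] = (map_poly j h).[z]^-1.
    move=> qz; have : (map_poly j (u * h + v * q)).[z] = 1.
      by rewrite uv rmorph1 hornerC.
    rewrite rmorphD !rmorphM hornerD !hornerM (rootP qz) mulr0 addr0 => e.
    have hz : (map_poly j h).[z] != 0.
      by apply: contra_eq_neq e => ->; rewrite mulr0 eq_sym oner_neq0.
    by rewrite -[RHS]mul1r -e mulfK.
  by exists (g * u); rewrite !rmorphM !hornerM !inv.
move=> z [g [g0 ->]]; have /dvdpP[u ->] : q %| g by apply: hdvd; apply/rootP.
by rewrite rmorphM hornerM (rootP qy) mulr0.
Qed.

Lemma minpoly_sft (F : set L) (hF : is_subfield F) x q :
  is_minpoly F x (map_poly (sfv hF) q) ->
  (forall g, ~~ root (map_poly (sfv hF) g) x -> coprimep g q) /\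
  (forall g, root (map_poly (sfv hF) g) x -> q %| g).
Proof.
move=> hq; split=> g hg.
  by rewrite -(coprimep_map (sfv hF)); apply: (minpoly_coprime hF hq) => //; apply: pover_map.
by rewrite -(dvdp_map (sfv hF)); apply: (minpoly_dvd hF hq) => //; apply: pover_map.
Qed.

Lemma embedding_domain R : partial_embedding R ->
  is_subfield [set x | exists y, R (x, y)].
Proof.
case=> R1 RB RV _; apply: is_subfieldP; split.
- by exists 1.
- by move=> x x' [y h] [y' h']; exists (y - y'); apply: RB.
- by move=> x x' [y h] [y' h']; exists (y / y'); apply: RV.
Qed.

Lemma embeddingM R : partial_embedding R ->
  forall x y x' y', R (x, y) -> R (x', y') -> R (x * x', y * y').
Proof.
case=> R1 RB RV _ x y x' y' h h'.
have := RV _ _ _ _ h (RV _ _ _ _ R1 h').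
by rewrite !div1r !invrK.
Qed.

(** The minimal polynomial of [x] over the domain is transported by the embedding; any root of the
    result in [L] can be the image of [x]. *)
Lemma embedding_extend R x : partial_embedding R ->
  algebraic_over [set x | exists y, R (x, y)] x ->
  exists R' y, [/\ partial_embedding R', R `<=` R' & R' (x, y)].
Proof.
move=> hR alg; have hD := embedding_domain hR.
have [R1 RB RV R0] := hR; have RM := embeddingM hR.
have [phi hphi] : exists phi : {rmorphism sft hD -> L}, forall z, R (sfv hD z, phi z).
  apply: (@rmorphism_of_graph _ _ (fun z y => R (sfv hD z, y))).
  - by move=> z; have := sfvP z.
  - by move=> y; rewrite rmorph0; apply: R0.
  - by rewrite rmorph1.
  - by move=> z y z' y' h h'; rewrite rmorphB; apply: RB.
  - by move=> z y z' y' h h'; rewrite rmorphM; apply: RM.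
have [q0 hq] := minpoly_ex hD alg.
have /(poverP hD)[q qE] := minpoly_over hD hq; rewrite qE in hq.
have [hcop hdvd] := minpoly_sft hq.
have /closed_rootP[y qy] : size (map_poly phi q) != 1%N.
  by have := minpoly_size_gt1 hq; rewrite !size_map_poly; case: (size q) => [|[]].
have := adjoin_embedding hcop hdvd (minpoly_root hq) qy.
set R' := [set z | _] => hR'; exists R', y; split=> //.
  move=> [z1 z2] hz.
  have [z zE] : exists z : sft hD, sfv hD z = z1 by apply: sfv_ex; exists z2.
  exists z%:P; rewrite !map_polyC !hornerC.
  congr pair; first exact/esym.
  apply/eqP; rewrite -subr_eq0; apply/eqP/R0.
  by rewrite -(subrr z1); apply: RB => //; rewrite -zE; apply: hphi.
by exists 'X; rewrite !map_polyX !hornerX.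
Qed.

Definition fixes (F : set L) (s : L -> L) := forall x, F x -> s x = x.

Theorem conjugate_embedding (F : set L) b b' : is_subfield F ->
  (forall x, algebraic_over F x) -> conjugate F b b' ->
  exists2 s : {rmorphism L -> L}, fixes F s & s b = b'.
Proof.
move=> hF alg [q0 hq q0b'].
have /(poverP hF)[q qE] := minpoly_over hF hq; rewrite qE in hq q0b'.
have [hcop hdvd] := minpoly_sft hq.
have := adjoin_embedding hcop hdvd (minpoly_root hq) q0b'.
set R0 := [set z | _] => hR0.
(* Maximising [A] subject to a condition on the union of [A] and [R0] covers the empty chain too:
   its union leaves [R0], which is a partial embedding. *)
have [] := @Zorn_bigcup _ (fun A => partial_embedding (A `|` R0)).
  move=> C CP Ctot; have [[A0 CA0]|C0] := pselect (exists A, C A); last first.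
    rewrite (_ : \bigcup_(X in C) X = set0) ?set0U //.
    by apply/seteqP; split=> // z [X CX]; case: C0; exists X.
  have sub2 z z' : (\bigcup_(X in C) X `|` R0) z -> (\bigcup_(X in C) X `|` R0) z' ->
      exists2 A, C A & (A `|` R0) z /\ (A `|` R0) z'.
    case=> [[A CA Az]|z0] [[B CB Bz]|z0'].
    - have [AB|BA] := Ctot _ _ CA CB; [exists B => //|exists A => //].
        by split; left=> //; apply: AB.
      by split; left=> //; apply: BA.
    - by exists A => //; split; [left|right].
    - by exists B => //; split; [right|left].
    - by exists A0 => //; split; right.
  have up A z : C A -> (A `|` R0) z -> (\bigcup_(X in C) X `|` R0) z.
    by move=> CA [Az|]; [left; exists A|right].
  split.
  - by apply: (up A0) => //; case: (CP _ CA0).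
  - move=> x y x' y' h h'; have [A CA [Az Az']] := sub2 _ _ h h'.
    by apply: (up A) => //; case: (CP _ CA) => _ hB _ _; apply: hB.
  - move=> x y x' y' h h'; have [A CA [Az Az']] := sub2 _ _ h h'.
    by apply: (up A) => //; case: (CP _ CA) => _ _ hV _; apply: hV.
  - move=> y h; have [A CA [Az _]] := sub2 _ _ h h.
    by case: (CP _ CA) => _ _ _; apply.
move=> A [hA maxA]; set R := A `|` R0 in hA.
have FR x : F x -> R (x, x).
  move=> Fx; right; have [z <-] := sfv_ex hF Fx.
  by exists z%:P; rewrite !map_polyC !hornerC.
have tot x : exists y, R (x, y).
  have [] := @embedding_extend R x hA.
    by apply: (algebraic_over_sub _ (alg x)) => z Fz; exists z; apply: FR.
  move=> R' [y [hR' sR R'xy]]; exists y; apply: contrapT => nR.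
  apply: (maxA R'); last first.
    by rewrite setUidl // => z hz; apply: sR; right.
  split; first by move=> z Az; apply: sR; left.
  by move=> /(_ _ R'xy) Axy; apply: nR; left.
case: (hA) => R1 RB RV R00.
have [s hs] := rmorphism_of_graph (R := fun x y => R (x, y)) tot R00 R1 RB (embeddingM hA).
have uniqR x y : R (x, y) -> s x = y.
  move=> Rxy; apply/eqP; rewrite -subr_eq0; apply/eqP/R00.
  by rewrite -(subrr x); apply: RB.
exists s => [x Fx|]; first exact/uniqR/FR.
by apply: uniqR; right; exists 'X; rewrite !map_polyX !hornerX.
Qed.

End Extension.

Section Conjugates.
Variable L : closedFieldType.
Implicit Types (F E : set L) (s : {rmorphism L -> L}) (r : seq L).

Lemma fixes_poly F s q : fixes F s -> pover F q -> map_poly s q = q.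
Proof. by move=> hs hq; apply/polyP => i; rewrite coef_map; apply: hs. Qed.

Lemma fixes_root F s q x : fixes F s -> pover F q -> root q x -> root q (s x).
Proof.
by move=> hs hq qx; rewrite -(fixes_poly hs hq) fmorph_root.
Qed.

Lemma fixes_sub F E (s : L -> L) : F `<=` E -> fixes E s -> fixes F s.
Proof. by move=> sF hs x /sF/hs. Qed.

Lemma fixes_conjugate F s b : is_subfield F -> (forall x, algebraic_over F x) ->
  fixes F s -> conjugate F b (s b).
Proof.
move=> hF alg hs; have [q hq] := minpoly_ex hF (alg b); exists q => //.
exact: (fixes_root hs (minpoly_over hF hq) (minpoly_root hq)).
Qed.

Lemma sep_roots F b : is_subfield F -> separable_over F b ->
  exists2 r, uniq r & is_minpoly F b (\prod_(x <- r) ('X - x%:P)).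
Proof.
move=> hF [q hq sq]; have [r qE] := closed_field_poly_normal q.
have := minpoly_monic hq; rewrite monicE => /eqP lq; rewrite lq scale1r in qE.
by rewrite qE in sq hq; exists r => //; rewrite -separable_prod_XsubC.
Qed.

(** An injective self-map of a finite set is a permutation, so endomorphisms serve as automorphisms
    on sets of roots. *)
Lemma stable_surj r s : uniq r -> (forall x, x \in r -> s x \in r) ->
  perm_eq (map s r) r.
Proof.
move=> ur st; have um : uniq (map s r) by rewrite map_inj_uniq //; apply: fmorph_inj.
have sub : {subset map s r <= r} by move=> _ /mapP[x xr ->]; apply: st.
apply: uniq_perm => //.
by case: (uniq_min_size um sub); rewrite ?size_map.
Qed.

Lemma stable_mem r s x : uniq r -> (forall x, x \in r -> s x \in r) ->
  (s x \in r) = (x \in r).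
Proof.
move=> ur st; rewrite -(perm_mem (stable_surj ur st)) mem_map //.
exact: fmorph_inj.
Qed.

Lemma map_prod_XsubC r s : 
  map_poly s (\prod_(x <- r) ('X - x%:P)) = \prod_(x <- map s r) ('X - x%:P).
Proof.
rewrite rmorph_prod big_map; apply: eq_bigr => x _.
by rewrite rmorphB /= map_polyX map_polyC.
Qed.

Lemma stable_prod_map r s : uniq r -> (forall x, x \in r -> s x \in r) ->
  map_poly s (\prod_(x <- r) ('X - x%:P)) = \prod_(x <- r) ('X - x%:P).
Proof.
by move=> ur st; rewrite map_prod_XsubC (perm_big _ (stable_surj ur st)).
Qed.

Section Over.
Variables (F : set L) (hF : is_subfield F) (alg : forall x, algebraic_over F x).

Section Roots.
Variables (b : L) (r : seq L).
Hypothesis hr : is_minpoly F b (\prod_(x <- r) ('X - x%:P)).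

Lemma conj_mem s : fixes F s -> s b \in r.
Proof.
move=> hs; rewrite -root_prod_XsubC.
exact: (fixes_root hs (minpoly_over hF hr) (minpoly_root hr)).
Qed.

Lemma conj_stable s x : fixes F s -> x \in r -> s x \in r.
Proof.
rewrite -!root_prod_XsubC => hs.
exact: (fixes_root hs (minpoly_over hF hr)).
Qed.

Lemma conj_ex x : x \in r -> exists2 s : {rmorphism L -> L}, fixes F s & s b = x.
Proof.
move=> xr; apply: conjugate_embedding => //.
by exists (\prod_(x <- r) ('X - x%:P)); rewrite ?root_prod_XsubC.
Qed.

Lemma conj_self : b \in r.
Proof. by rewrite -root_prod_XsubC; apply: minpoly_root hr. Qed.

Lemma conj_size : size r = deg F b.
Proof. by rewrite (degE hF hr) size_prod_XsubC. Qed.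

End Roots.

(* If [x = g(a)] is fixed then [g - x] vanishes at every conjugate of [a], so
   it has more roots than its degree allows. *)
Lemma fixed_mem a x : separable_over F a -> adjoin F a x ->
  (forall s, fixes F s -> s x = x) -> F x.
Proof.
move=> sa ax fx; have [r ur hr] := sep_roots hF sa.
have [g [Fg sg xg]] := adjoin_horner hF hr ax.
rewrite size_prod_XsubC ltnS in sg.
suff g0 : g - x%:P = 0.
  have := Fg 0; suff -> : g = x%:P by rewrite coefC.
  by apply/eqP; rewrite -subr_eq0 g0.
apply: (@roots_geq_poly_eq0 _ _ r) => //; last first.
  apply: leq_trans (size_polyD _ _) _; rewrite size_polyN geq_max sg /=.
  by rewrite (leq_trans (size_polyC_leq1 _)) // lt0n size_eq0; apply/eqP => r0;
     have := conj_self hr; rewrite r0.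
apply/allP => y /(conj_ex hr)[s hs <-].
have := fx s hs; rewrite {1}xg -horner_map (fixes_poly hs Fg) => e.
by rewrite rootE !hornerE e subrr.
Qed.

Lemma sep_fixed_mem x : separable_over F x ->
  (forall s, fixes F s -> s x = x) -> F x.
Proof. by move=> sx; apply: fixed_mem sx _; apply: mem_adjoin. Qed.

(** All conjugates of one member lie in [r], and their product is its minimal polynomial; removing
    them leaves a smaller stable set. *)
Lemma stable_prod_over r : uniq r -> (forall x, x \in r -> separable_over F x) ->
  (forall s x, fixes F s -> x \in r -> s x \in r) ->
  pover F (\prod_(x <- r) ('X - x%:P)).
Proof.
have [m] := ubnP (size r).
elim: m r => // m IH [|b r0]; first by rewrite big_nil => *; apply: poverC; rewrite ?subf1 //; apply: subf1.
set r := b :: r0; rewrite ltnS => szr ur sr st.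
have [rb urb hrb] := sep_roots hF (sr b (mem_head _ _)).
have sub : {subset rb <= r}.
  by move=> y /(conj_ex hrb)[s hs <-]; apply: st => //; apply: mem_head.
pose r' := [seq x <- r | x \notin rb].
have pr : perm_eq r (rb ++ r').
  apply: uniq_perm => //.
    rewrite cat_uniq urb filter_uniq // andbT /=.
    by apply/hasPn => y; rewrite mem_filter => /andP[].
  move=> y; rewrite mem_cat mem_filter.
  by case: (boolP (y \in rb)) => // /sub ->.
rewrite (perm_big _ pr) big_cat /=; apply: poverM => //.
  exact: (minpoly_over hF hrb).
apply: IH.
- have := perm_size pr; rewrite size_cat => e.
  apply: leq_trans szr; rewrite e -[X in (X < _)%N]add0n ltn_add2r.
  by have := conj_self hrb; case: (rb).
- exact: filter_uniq.
- by move=> x; rewrite mem_filter => /andP[_ /sr].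
move=> s x hs; rewrite !mem_filter => /andP[xrb /(st s _ hs) ->].
by rewrite (stable_mem _ urb) ?andbT // => y; apply: (conj_stable hrb).
Qed.

End Over.
End Conjugates.

(** * Valuations and residues *)

Section Valuations.
Variables (L : fieldType) (G : ogroupType) (w : valuation L G).
Implicit Types (x y z : L) (c d : with_infty G).

Lemma ogroup_leD2lr (a b c : G) : (a + c <= b + c) = (a <= b).
Proof.
apply/idP/idP => [|h]; last exact: ogroup_leD2r.
by move/(ogroup_leD2r _ _ (- c)); rewrite !addrK.
Qed.

Lemma wNone x : (w x == None) = (x == 0).
Proof. by apply/eqP/eqP => [/Defs.valE0//|->]; apply: Defs.val0. Qed.

Lemma wSome x : x != 0 -> exists g, w x = Some g.
Proof. by rewrite -wNone; case: (w x) => [g|] // _; exists g. Qed.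

Lemma vle_None c : (c <= None :> with_infty G) = true.
Proof. by case: c. Qed.

Lemma vaddC c d : vadd c d = vadd d c.
Proof. by case: c d => [a|] [b|] //=; rewrite addrC. Qed.

Lemma w_leM z x y : z != 0 -> (w (x * z) <= w (y * z)) = (w x <= w y).
Proof.
move=> /wSome[g gz]; rewrite !Defs.valM gz.
by case: (w x) (w y) => [a|] [b|] //; apply: ogroup_leD2lr.
Qed.

Lemma w_ltM z x y : z != 0 -> (w (x * z) < w (y * z)) = (w x < w y).
Proof. by move=> z0; rewrite !ltNge w_leM. Qed.

Lemma w_eqM z x y : z != 0 -> (w (x * z) == w (y * z)) = (w x == w y).
Proof. by move=> z0; rewrite !eq_le !w_leM. Qed.

Lemma w_le_div y x : y != 0 -> (w y <= w x) = (vzero G <= w (x / y)).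
Proof. by move=> y0; rewrite -(Defs.val1 w) -[in RHS](w_leM _ _ y0) mul1r divfK. Qed.

Lemma w_lt_div y x : y != 0 -> (w y < w x) = (vzero G < w (x / y)).
Proof. by move=> y0; rewrite -(Defs.val1 w) -[in RHS](w_ltM _ _ y0) mul1r divfK. Qed.

Lemma w_eq_div y x : y != 0 -> (w x == w y) = (w (x / y) == vzero G).
Proof. by move=> y0; rewrite -(Defs.val1 w) -[in RHS](w_eqM _ _ y0) mul1r divfK. Qed.

Lemma w_unit_neq0 x : w x = vzero G -> x != 0.
Proof. by move=> h; rewrite -wNone h. Qed.

Lemma w_unitM x y : w y = vzero G -> w (x * y) = w x.
Proof. by move=> h; rewrite Defs.valM h vaddC vadd0. Qed.

Lemma w_unitV x : w x = vzero G -> w x^-1 = vzero G.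
Proof.
move=> h; have x0 := w_unit_neq0 h.
by apply/eqP; rewrite -(Defs.val1 w) -(w_eqM _ _ x0) mulVf // mul1r h Defs.val1.
Qed.

Lemma w_congM x x' y y' : w x = w x' -> w y = w y' -> w (x * y) = w (x' * y').
Proof. by rewrite !Defs.valM => -> ->. Qed.

Lemma w_congX n x x' : w x = w x' -> w (x ^+ n) = w (x' ^+ n).
Proof.
by move=> h; elim: n => [|n IH]; rewrite ?expr0 // !exprS; apply: w_congM.
Qed.

Lemma w_ltX n x y : w x < w y -> (0 < n)%N -> w (x ^+ n) < w (y ^+ n).
Proof.
move=> lt; have x0 : x != 0.
  by rewrite -wNone; apply: contraTneq lt => ->; rewrite ltNge vle_None.
case: n => // n _; elim: n => [|n IH]; first by rewrite !expr1.
rewrite exprSr [y ^+ _]exprSr.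
apply: (@lt_le_trans _ _ (w (y ^+ n.+1 * x))).
  by rewrite w_ltM.
have [->|y0] := eqVneq y 0; first by rewrite mulr0 Defs.val0 vle_None.
by rewrite ![y ^+ _ * _]mulrC w_leM ?ltW // expf_neq0.
Qed.

Lemma w_ltXE n x y : (0 < n)%N -> (w (x ^+ n) < w (y ^+ n)) = (w x < w y).
Proof.
move=> n0; apply/idP/idP => [|lt]; last exact: w_ltX.
apply: contraTT; rewrite -!leNgt le_eqVlt => /orP[/eqP e|lt].
  by rewrite (w_congX n e).
by apply/ltW/w_ltX.
Qed.

Lemma wD_ge c x y : c <= w x -> c <= w y -> c <= w (x + y).
Proof. by move=> hx hy; apply: le_trans (Defs.valD w x y); rewrite le_min hx. Qed.

Lemma wD_gt c x y : c < w x -> c < w y -> c < w (x + y).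
Proof. by move=> hx hy; apply: lt_le_trans (Defs.valD w x y); rewrite lt_min hx. Qed.

Lemma wB_ge c x y : c <= w x -> c <= w y -> c <= w (x - y).
Proof. by move=> hx hy; apply: wD_ge => //; rewrite Defs.valN. Qed.

Lemma wB_gt c x y : c < w x -> c < w y -> c < w (x - y).
Proof. by move=> hx hy; apply: wD_gt => //; rewrite Defs.valN. Qed.

Lemma wBC x y : w (x - y) = w (y - x).
Proof. by rewrite -opprB Defs.valN. Qed.

Lemma w_dist c x y z : c <= w (x - y) -> c <= w (y - z) -> c <= w (x - z).
Proof. by move=> h h'; rewrite -[x](subrK y) -addrA; apply: wD_ge. Qed.

Lemma wD_lt x y : w x < w y -> w (x + y) = w x.
Proof.
move=> lt; apply/le_anti; rewrite wD_ge ?(ltW lt) // andbT leNgt.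
apply/negP => h; have : w x < w ((x + y) - y) by apply: wB_gt.
by rewrite addrK ltxx.
Qed.

Lemma wB_lt x y : w x < w y -> w (y - x) = w x.
Proof. by move=> lt; rewrite wBC -[x - y]/(x + - y) wD_lt ?Defs.valN. Qed.

Lemma w_sum_ge c (I : Type) (r : seq I) (P : pred I) (f : I -> L) :
  (forall i, P i -> c <= w (f i)) -> c <= w (\sum_(i <- r | P i) f i).
Proof.
move=> h; apply: (big_ind (fun x => c <= w x)) => //; first by rewrite Defs.val0 vle_None.
by move=> x y; apply: wD_ge.
Qed.

Lemma w_sum_gt c (I : Type) (r : seq I) (P : pred I) (f : I -> L) : c < None ->
  (forall i, P i -> c < w (f i)) -> c < w (\sum_(i <- r | P i) f i).
Proof.
move=> c0 h; apply: (big_ind (fun x => c < w x)) => //; first by rewrite Defs.val0.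
by move=> x y; apply: wD_gt.
Qed.

Lemma wM_ge0 x y : vzero G <= w x -> vzero G <= w y -> vzero G <= w (x * y).
Proof. by move=> hx hy; rewrite Defs.valM; apply: vge0_add. Qed.

Lemma wX_ge0 n x : vzero G <= w x -> vzero G <= w (x ^+ n).
Proof.
move=> hx; elim: n => [|n IH]; first by rewrite expr0 Defs.val1.
by rewrite exprS; apply: wM_ge0.
Qed.

Local Notation res := (residue w).
Local Notation "x \isint" := (vzero G <= w x) (at level 50).

(** [residue] sends elements outside the valuation ring to the default 0 and is not a ring morphism
    on [L]; hence the integrality hypotheses in the laws below. *)
Lemma resE x (hx : x \in val_ring w) :
  res x = \pi_(residue_field w)%qT (Sub x hx : val_ringT w).
Proof.
rewrite /residue; congr (\pi_(residue_field w)%qT _).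
by apply: val_inj; rewrite /= /insubd insubT.
Qed.

Lemma resD x y : x \isint -> y \isint -> res (x + y) = res x + res y.
Proof.
move=> hx hy; have hxy : x + y \isint by apply: wD_ge.
rewrite (resE (hx : x \in val_ring w)) (resE (hy : y \in val_ring w)).
rewrite (resE (hxy : x + y \in val_ring w)) -rmorphD.
by congr (\pi_(residue_field w)%qT _); apply: val_inj.
Qed.

Lemma resM x y : x \isint -> y \isint -> res (x * y) = res x * res y.
Proof.
move=> hx hy; have hxy : x * y \isint by apply: wM_ge0.
rewrite (resE (hx : x \in val_ring w)) (resE (hy : y \in val_ring w)).
rewrite (resE (hxy : x * y \in val_ring w)) -rmorphM.
by congr (\pi_(residue_field w)%qT _); apply: val_inj.
Qed.

Lemma res1 : res 1 = 1.
Proof.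
have h : 1 \isint by rewrite Defs.val1.
rewrite (resE (h : 1 \in val_ring w)) -(rmorph1 \pi_(residue_field w)%qT).
by congr (\pi_(residue_field w)%qT _); apply: val_inj.
Qed.

Lemma res0 : res 0 = 0.
Proof.
have h : 0 \isint by rewrite Defs.val0.
rewrite (resE (h : 0 \in val_ring w)) -(rmorph0 \pi_(residue_field w)%qT).
by congr (\pi_(residue_field w)%qT _); apply: val_inj.
Qed.

Lemma res_eq0 x : x \isint -> (res x == 0) = (vzero G < w x).
Proof.
move=> hx; rewrite (resE (hx : x \in val_ring w)).
rewrite -(rmorph0 \pi_(residue_field w)%qT) -Quotient.idealrBE subr0.
by rewrite unfold_in.
Qed.

Lemma resN x : x \isint -> res (- x) = - res x.
Proof.
move=> hx; apply/eqP; rewrite -addr_eq0 -resD ?Defs.valN //.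
by rewrite addNr res0.
Qed.

Lemma resB x y : x \isint -> y \isint -> res (x - y) = res x - res y.
Proof. by move=> hx hy; rewrite resD ?Defs.valN // resN. Qed.

Lemma res_eq x y : x \isint -> y \isint -> (res x == res y) = (vzero G < w (x - y)).
Proof. by move=> hx hy; rewrite -subr_eq0 -resB // res_eq0 // wB_ge. Qed.

Lemma resX n x : x \isint -> res (x ^+ n) = res x ^+ n.
Proof.
move=> hx; elim: n => [|n IH]; first by rewrite !expr0 res1.
by rewrite !exprS resM ?IH // wX_ge0.
Qed.

Lemma res_unit x : x \isint -> (res x != 0) = (w x == vzero G).
Proof.
move=> hx; rewrite res_eq0 // lt_neqAle hx andbT negbK.
by rewrite eq_sym.
Qed.

Lemma resV x : w x = vzero G -> res x^-1 = (res x)^-1.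
Proof.
move=> hx; have x0 := w_unit_neq0 hx; have rx : res x != 0 by rewrite res_unit ?hx.
by apply: (mulfI rx); rewrite divff // -resM ?hx ?w_unitV // divff // res1.
Qed.

Lemma res_sum (I : Type) (r : seq I) (f : I -> L) :
  (forall i, f i \isint) -> res (\sum_(i <- r) f i) = \sum_(i <- r) res (f i).
Proof.
move=> h; elim: r => [|i r IH]; first by rewrite !big_nil res0.
by rewrite !big_cons resD ?IH // w_sum_ge.
Qed.

Lemma residuesP (E : set L) q :
  @residues _ _ w E q <-> exists x, [/\ E x, x \isint & res x = q].
Proof.
split=> [[x [Ex hx] <-]|[x [Ex hx <-]]]; first by exists x.
by exists x.
Qed.

Lemma residues_subfield (E : set L) : is_subfield E -> is_subfield (@residues _ _ w E).
Proof.
move=> hE; apply: is_subfieldP; split.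
- by apply/residuesP; exists 1; rewrite Defs.val1 res1; split=> //; apply: subf1.
- move=> _ _ /residuesP[x [Ex hx <-]] /residuesP[y [Ey hy <-]].
  apply/residuesP; exists (x - y).
  by rewrite resB ?wB_ge //; split=> //; apply: subfB.
move=> _ _ /residuesP[x [Ex hx <-]] /residuesP[y [Ey hy <-]].
have [y0|y0] := eqVneq (res y) 0.
  by rewrite y0 invr0 mulr0; apply/residuesP; exists 0; rewrite Defs.val0 res0; split=> //; apply: subf0.
move: (y0); rewrite res_unit // => /eqP uy.
apply/residuesP; exists (x / y); split; first exact: subfV2.
  by rewrite wM_ge0 // w_unitV.
by rewrite resM ?resV ?w_unitV.
Qed.

Lemma residues_sub (E E' : set L) : E `<=` E' -> @residues _ _ w E `<=` @residues _ _ w E'.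
Proof.
by move=> sE _ /residuesP[x [/sE Ex hx <-]]; apply/residuesP; exists x.
Qed.

End Valuations.

(** * The fundamental inequality *)

Section CosetIndex.
Variable G : zmodType.
Implicit Types A B C : set G.

Definition is_subgroup A := A 0 /\ forall x y, A x -> A y -> A (x - y).

Lemma subgroupN A x : is_subgroup A -> A x -> A (- x).
Proof. by case=> A0 AB Ax; rewrite -sub0r; apply: AB. Qed.

Lemma subgroupD A x y : is_subgroup A -> A x -> A y -> A (x + y).
Proof. by move=> hA Ax Ay; rewrite -[y]opprK; apply: (proj2 hA) => //; apply: subgroupN. Qed.

Lemma subgroup_sum A (I : finType) (f : I -> G) : is_subgroup A ->
  (forall i, A (f i)) -> A (\sum_i f i).
Proof.
move=> hA h; apply: (big_ind A) => //; first by case: hA.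
by move=> x y; apply: subgroupD.
Qed.

Definition incongruent B (I : Type) (t : I -> G) :=
  forall i j, B (t i - t j) -> i = j.

Definition coset_transversal A B (I : finType) (t : I -> G) :=
  [/\ forall i, A (t i), incongruent B t
    & forall g, A g -> exists i, B (g - t i)].

Lemma coset_indexE A B (I : finType) (t : I -> G) : is_subgroup B ->
  coset_transversal A B t -> coset_index A B = #|I|.
Proof.
move=> hB [At it tt].
pose coset g := [set g + h | h in B].
have cosetE g g' : coset g = coset g' <-> B (g - g').
  split=> [e|Bgg'].
    have : coset g g by exists 0; rewrite ?addr0 //; case: hB.
    by rewrite e => -[h Bh <-]; rewrite addrC addKr.
  apply/seteqP; split=> _ [h Bh <-].
    by exists (g - g' + h); [apply: subgroupD|rewrite addrA [g' + _]addrC subrK].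
  exists (g' - g + h); last by rewrite addrA [g + _]addrC subrK.
  by apply: subgroupD => //; rewrite -opprB; apply: subgroupN.
have cardA : [set coset g | g in A] #= `I_#|I|.
  have -> : [set coset g | g in A] =
      (fun i : 'I_#|I| => coset (t (enum_val i))) @` [set: 'I_#|I|].
    apply/seteqP; split=> [_ [g Ag <-]|_ [i _ <-]]; last by exists (t (enum_val i)).
    have [i Bi] := tt g Ag; exists (enum_rank i) => //.
    rewrite enum_rankK; apply/cosetE; rewrite -opprB; exact: subgroupN.
  apply: card_eq_trans (card_esym card_II).
  apply: inj_card_eq => i j _ _ /cosetE/it; exact: enum_val_inj.
rewrite /coset_index; case: xgetP => [n _ /= hn|/(_ #|I|)[]] //.
by apply/card_eq_II; apply: card_eq_trans cardA; apply: card_esym.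
Qed.

Lemma incongruent_inj B (I J : Type) (h : J -> I) (t : I -> G) :
  injective h -> incongruent B t -> incongruent B (t \o h).
Proof. by move=> hi it i j /it/hi. Qed.

Lemma transversal_ex A B N : is_subgroup B ->
  (forall n (t : 'I_n -> G), (forall i, A (t i)) -> incongruent B t -> (n <= N)%N) ->
  exists n (t : 'I_n -> G), coset_transversal A B t.
Proof.
move=> hB hN.
pose P n := `[< exists2 t : 'I_n -> G, forall i, A (t i) & incongruent B t >].
have P0 : exists n, P n.
  by exists 0%N; apply/asboolP; exists (fun=> 0); case.
have PN n : P n -> (n <= N)%N by case/asboolP => t; apply: hN.
case: (ex_maxnP P0 PN) => n /asboolP[t At it] nmax.
exists n, t; split=> // g Ag; apply: contrapT => hg.
pose t' (o : option 'I_n) := if o is Some i then t i else g.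
have it' : incongruent B t'.
  move=> [i|] [j|] //= h; first by rewrite (it i j).
    by case: hg; exists i; rewrite -opprB; apply: subgroupN.
  by case: hg; exists j.
have : P #|{: option 'I_n}|.
  apply/asboolP; exists (t' \o enum_val) => [i|].
    by rewrite /t' /=; case: (enum_val i).
  by apply: incongruent_inj it'; apply: enum_val_inj.
by move/nmax; rewrite card_option card_ord ltnn.
Qed.

Lemma transversal_mul A B C (I J : finType) (t : I -> G) (u : J -> G) :
  is_subgroup C -> is_subgroup B -> is_subgroup A -> C `<=` B -> B `<=` A ->
  coset_transversal A B t -> coset_transversal B C u ->
  coset_transversal A C (fun ij : I * J => t ij.1 + u ij.2).
Proof.
move=> hC hB hA sCB sBA [At it tt] [Bu iu tu]; split.
- by move=> [i j] /=; apply: subgroupD => //; apply: sBA.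
- move=> [i j] [i' j'] /= h.
  have eij (a b c d : G) : a + b - (c + d) = (a - c) + (b - d).
    by rewrite opprD addrACA.
  rewrite eij in h; have e : i = i'.
    apply: it; rewrite -[_ - _](addrK (u j - u j')).
    exact: (proj2 hB _ _ (sCB _ h) (proj2 hB _ _ (Bu j) (Bu j'))).
  by rewrite e subrr add0r in h; rewrite e (iu _ _ h).
move=> g /tt[i /tu[j h]]; exists (i, j) => /=.
by rewrite opprD addrA.
Qed.

Lemma transversal_le A B (I J : finType) (t : I -> G) (u : J -> G) :
  is_subgroup B -> coset_transversal A B t -> (forall j, A (u j)) -> incongruent B u ->
  (#|J| <= #|I|)%N.
Proof.
move=> hB [At it tt] Au iu.
have /choice[f hf] : forall j, exists i, B (u j - t i) by move=> j; apply: tt.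
apply: (@leq_card _ _ f) => j j' e; apply: iu.
have -> : u j - u j' = (u j - t (f j)) - (u j' - t (f j')).
  by rewrite e opprB addrA subrK.
exact: (proj2 hB).
Qed.

(* Translation by [g] permutes the cosets, so it does not change the sum of the
   representatives modulo [B]. *)
Lemma transversal_mulrn A B (I : finType) (t : I -> G) g : is_subgroup B ->
  is_subgroup A -> coset_transversal A B t -> A g -> B (g *+ #|I|).
Proof.
move=> hB hA [At it tt] Ag.
have /choice[f hf] : forall i, exists j, B (t i + g - t j).
  by move=> i; apply: tt; apply: subgroupD.
have fi : injective f.
  move=> i j e; apply: it.
  have -> : t i - t j = (t i + g - t (f i)) - (t j + g - t (f j)).
    by rewrite e opprB addrA subrK opprD addrACA subrr addr0.
  by apply: (proj2 hB).
have := subgroup_sum hB hf.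
rewrite sumrB big_split /= sumr_const -(reindex_inj (F := t) fi (P := xpredT)) /=.
by rewrite addrC addrK.
Qed.

Lemma transversal_gt0 A B (I : finType) (t : I -> G) : A 0 ->
  coset_transversal A B t -> (0 < #|I|)%N.
Proof. by move=> A0 [_ _ tt]; have [i _] := tt _ A0; apply/card_gt0P; exists i. Qed.

End CosetIndex.

Section ValuationIndependence.
Variables (L : fieldType) (G : ogroupType) (w : valuation L G).
Implicit Types (F E : set L).
Local Notation vg E := (value_group w E).
Local Notation rs E := (@residues _ _ w E).

Lemma vg_subgroup E : is_subfield E -> is_subgroup (vg E).
Proof.
move=> hE; split; first by exists 1; [apply: subf1|apply: Defs.val1].
move=> g h [x Ex xg] [y Ey yh]; exists (x / y); first exact: subfV2.
have y0 : y != 0 by rewrite -(wNone w) yh.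
have := Defs.valM w (x / y) y; rewrite divfK // xg yh.
by case: (w (x / y)) => [a|] //= [->]; rewrite addrK.
Qed.

Lemma vg_sub F E : F `<=` E -> vg F `<=` vg E.
Proof. by move=> sF g [x Fx xg]; exists x => //; apply: sF. Qed.

Lemma exists_min (I : finType) (f : I -> with_infty G) (i0 : I) :
  exists i, forall j, f i <= f j.
Proof.
have [i _ h] := Order.TotalTheory.arg_minP f (isT : xpredT i0).
by exists i => j; apply: h.
Qed.

(** Strict minimality of one term determines the value of the sum. Zero terms are exempted because
    they share the value infinity. *)
Lemma w_sum_distinct (I : finType) (z : I -> L) :
  (forall i j, i != j -> z i != 0 -> w (z i) != w (z j)) ->
  forall i, w (\sum_j z j) <= w (z i).
Proof.
move=> hz i; have [i0 hi0] := exists_min (w \o z) i.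
apply: le_trans (hi0 i); rewrite /=.
have [z0|z0] := eqVneq (z i0) 0; first by rewrite z0 Defs.val0 vle_None.
rewrite (bigD1 i0) //= wD_lt //; apply: w_sum_gt => [|j jn].
  by rewrite lt_neqAle vle_None andbT wNone.
rewrite lt_neqAle; apply/andP; split; last exact: (hi0 j).
by apply: hz => //; rewrite eq_sym.
Qed.

Lemma w_le_mul x y : vzero G <= w y -> w x <= w (x * y).
Proof.
move=> hy; have [->|x0] := eqVneq x 0; first by rewrite mul0r.
by rewrite w_le_div // mulrAC divff // mul1r.
Qed.

(** Valuation independence: the value of the sum is the minimum of the values of its terms, the
    other inequality being the ultrametric one. *)
Definition vindep F (I : finType) (e : I -> L) :=
  forall c : I -> L, (forall i, F (c i)) ->
  forall i, w (\sum_j c j * e j) <= w (c i * e i).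

Lemma vindep_indep F (I : finType) (e : I -> L) : (forall i, e i != 0) ->
  vindep F e -> indep F e.
Proof.
move=> e0 he c Fc c0 i; have := he c Fc i; rewrite c0 Defs.val0.
move=> h; have : w (c i * e i) == None by rewrite eq_le vle_None.
by rewrite wNone mulf_eq0 (negPf (e0 i)) orbF => /eqP.
Qed.

(** After division by a coefficient of least value, a sum of positive value would reduce to a
    residue relation with a coefficient 1. So a nonzero sum has the value of one of its
    coefficients, which lies in the value group of [F]. *)
Lemma sum_residue_indep F (J : finType) (u d : J -> L) : is_subfield F ->
  (forall j, vzero G <= w (u j)) -> indep (rs F) (fun j => residue w (u j)) ->
  (forall j, F (d j)) ->
  \sum_j d j * u j = 0 /\ (forall j, d j = 0) \/
  exists j0, [/\ d j0 != 0, w (\sum_j d j * u j) = w (d j0)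
    & forall j, w (d j0) <= w (d j)].
Proof.
move=> hF u0 iu Fd; have [[j1]|nJ] := pselect (exists j : J, True); last first.
  by left; split=> [|j]; [rewrite big1 // => j|]; case: nJ; exists j.
move=> _; have [j0 hj0] := exists_min (w \o d) j1.
have [d0|d0] := eqVneq (d j0) 0.
  left; have dj j : d j = 0.
    apply/eqP; rewrite -(wNone w) eq_le vle_None /=.
    by rewrite -(Defs.val0 w) -d0; apply: hj0.
  by split=> //; rewrite big1 // => j _; rewrite dj mul0r.
right; exists j0; split=> //.
have q0 j : vzero G <= w (d j / d j0) by rewrite -w_le_div //; apply: hj0.
have -> : \sum_j d j * u j = d j0 * \sum_j d j / d j0 * u j.
  by rewrite mulr_sumr; apply: eq_bigr => j _; rewrite mulrA mulrCA divff // mulr1.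
apply: w_unitM; apply/eqP; rewrite -res_unit; last first.
  by apply: w_sum_ge => j _; apply: wM_ge0.
rewrite res_sum => [|j]; last exact: wM_ge0.
apply/eqP => s0; have /(_ j0) : forall j, residue w (d j / d j0) = 0.
  apply: iu => [j|].
    by apply/residuesP; exists (d j / d j0); split=> //; apply: subfV2.
  rewrite -[RHS]s0; apply: eq_bigr => j _.
  by rewrite (resM (q0 j) (u0 j)).
by rewrite divff // res1 => /eqP; rewrite oner_eq0.
Qed.

(** The inner sums over [J] have values in [vF], so the outer terms lie in distinct cosets of [vF]
    and their values cannot coincide. *)
Lemma vindep_mul F (I J : finType) (p : I -> L) (t : I -> G) (u : J -> L) :
  is_subfield F -> (forall i, w (p i) = Some (t i)) ->
  incongruent (vg F) t -> (forall j, vzero G <= w (u j)) ->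
  indep (rs F) (fun j => residue w (u j)) ->
  vindep F (fun ij : I * J => p ij.1 * u ij.2).
Proof.
move=> hF pt it u0 iu c Fc [i j] /=.
pose y i := \sum_j c (i, j) * u j.
have -> : \sum_k c k * (p k.1 * u k.2) = \sum_i y i * p i.
  rewrite (eq_bigr (fun i => \sum_j c (i, j) * (p i * u j))).
    by rewrite pair_bigA; apply: eq_bigr => -[].
  move=> k _; rewrite mulr_suml; apply: eq_bigr => l _.
  by rewrite mulrAC mulrA.
have hy k := sum_residue_indep hF u0 iu (fun l => Fc (k, l)).
have p0 k : p k != 0 by rewrite -(wNone w) pt.
apply: (@le_trans _ _ (w (y i * p i))).
  apply: w_sum_distinct => k l kl yp0; apply: contra kl => /eqP e.
  have yw m : y m * p m != 0 -> exists2 g, vg F g & w (y m * p m) = Some (g + t m).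
    case: (hy m) => [[ym0 _]|[k0 [ck wk _]] _].
      by rewrite /y ym0 mul0r eqxx.
    have [g gE] := wSome w ck; exists g; first by exists (c (m, k0)).
    by rewrite Defs.valM -/(y m) -?/(y m) /y wk gE pt.
  have yp0' : y l * p l != 0 by rewrite -(wNone w) -e wNone.
  have [g hg gE] := yw k yp0; have [h hh hE] := yw l yp0'.
  move: e; rewrite gE hE => -[e]; apply/eqP/it.
  suff -> : t k - t l = h - g by apply: (proj2 (vg_subgroup hF)).
  by apply/eqP; rewrite subr_eq addrAC -e addrC addKr.
rewrite mulrA; apply: le_trans (w_le_mul _ (u0 j)).
rewrite w_leM //; case: (hy i) => [[yi0 ->]|[k0 [_ wk hk]]].
  by rewrite Defs.val0 vle_None.
by rewrite /y wk.
Qed.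

End ValuationIndependence.

Section FundamentalInequality.
Variables (L : fieldType) (G : ogroupType) (w : valuation L G).
Variables (F E : set L).
Hypotheses (hF : is_subfield F) (hE : is_subfield E).
Hypothesis fin : finite_ext F E.
Local Notation vg E := (value_group w E).
Local Notation rs E := (@residues _ _ w E).

Lemma vg_lift (I : Type) (t : I -> G) : (forall i, vg E (t i)) ->
  exists p : I -> L, forall i, E (p i) /\ w (p i) = Some (t i).
Proof.
move=> Et; suff /choice[p hp] : forall i, exists x, E x /\ w x = Some (t i) by exists p.
by move=> i; have [x] := Et i; exists x.
Qed.

Lemma rs_lift (I : Type) (q : I -> residue_field w) : (forall i, rs E (q i)) ->
  exists u : I -> L, forall i, [/\ E (u i), vzero G <= w (u i) & residue w (u i) = q i].
Proof.
move=> Eq; suff /choice[p hp] : forall i, exists x, [/\ E x, vzero G <= w x & residue w x = q i].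
  by exists p.
by move=> i; apply/residuesP.
Qed.

Lemma vindep_family (I J : finType) (t : I -> G) (q : J -> residue_field w) :
  (forall i, vg E (t i)) -> incongruent (vg F) t ->
  (forall j, rs E (q j)) -> indep (rs F) q ->
  exists e : I * J -> L, [/\ forall k, E (e k), indep F e, vindep w F e
    & #|{: I * J}| = (#|I| * #|J|)%N].
Proof.
move=> Et it Eq iq; have [p hp] := vg_lift Et; have [u hu] := rs_lift Eq.
have iu : indep (rs F) (fun j => residue w (u j)).
  by rewrite (_ : (fun j => _) = q) //; apply/funext => j; case: (hu j).
have vi : vindep w F (fun ij : I * J => p ij.1 * u ij.2).
  apply: (vindep_mul hF _ it _ iu) => [i|j]; first by case: (hp i).
  by case: (hu j).
exists (fun ij : I * J => p ij.1 * u ij.2); split=> //.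
- by move=> [i j]; apply: (subfM hE); [case: (hp i)|case: (hu j)].
- apply: vindep_indep vi => -[i j] /=; rewrite mulf_neq0 //.
    by rewrite -(wNone w); case: (hp i) => _ ->.
  (* An independent family has no zero member: the coefficients [(k == j)%:R] would give a
     relation. *)
  apply/negP => /eqP uj0; have hR := residues_subfield w hF.
  suff /(_ j)/eqP : forall k, (k == j)%:R = 0 :> residue_field w by rewrite eqxx oner_eq0.
  apply: iu => [k|]; first exact: subf_nat.
  rewrite (bigD1 j) //= uj0 res0 mulr0 add0r big1 // => k /negPf ->.
  by rewrite mul0r.
exact: card_prod.
Qed.

Lemma fundamental_le (I J : finType) (t : I -> G) (q : J -> residue_field w) :
  (forall i, vg E (t i)) -> incongruent (vg F) t ->
  (forall j, rs E (q j)) -> indep (rs F) q -> (#|I| * #|J| <= degree F E)%N.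
Proof.
move=> Et it Eq iq; have [e [Ee ie _ <-]] := vindep_family Et it Eq iq.
exact: (indep_le_degree hF fin Ee ie).
Qed.

(** With this family, or with the single value 0, [fundamental_le] bounds one factor at a time and
    yields finiteness of both. *)
Lemma indep1 (k : set (residue_field w)) : indep k (fun=> 1 : residue_field w) (I := 'I_1).
Proof.
by move=> c _; rewrite big_ord_recl big_ord0 addr0 mulr1 => c0 i; rewrite (ord1 i).
Qed.

Lemma rami_ex : exists n (t : 'I_n -> G), coset_transversal (vg E) (vg F) t.
Proof.
apply: (@transversal_ex _ _ _ (degree F E)); first exact: vg_subgroup.
move=> n t Et it; have := fundamental_le Et it (q := fun _ : 'I_1 => 1) _ (@indep1 _).
rewrite !card_ord muln1; apply=> _; apply: subf1; exact: residues_subfield.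
Qed.

Lemma residues_finite : finite_ext (rs F) (rs E).
Proof.
apply: (@bounded_finite _ _ _ (degree F E)); first exact: residues_subfield.
move=> n q Eq iq; have := @fundamental_le 'I_1 'I_n (fun=> 0) q _ _ Eq iq.
rewrite !card_ord mul1n; apply=> [_|i j _]; last by rewrite !ord1.
by case: (vg_subgroup w hE).
Qed.

Lemma ramE (I : finType) (t : I -> G) : coset_transversal (vg E) (vg F) t ->
  ram_index w F E = #|I|.
Proof. by apply: coset_indexE; apply: vg_subgroup. Qed.

Lemma ram_transversal : exists t : 'I_(ram_index w F E) -> G,
  coset_transversal (vg E) (vg F) t.
Proof.
have [n [t ht]] := rami_ex.
by have := ramE ht; rewrite card_ord => ->; exists t.
Qed.

Lemma ram_gt0 : (0 < ram_index w F E)%N.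
Proof.
have [t ht] := ram_transversal; rewrite -[ram_index _ _ _]card_ord.
by apply: transversal_gt0 ht; case: (vg_subgroup w hE).
Qed.

Lemma resdeg_gt0 : (0 < residue_degree w F E)%N.
Proof.
by apply: degree_gt0 residues_finite; apply: residues_subfield.
Qed.

Lemma fundamental_inequality :
  (ram_index w F E * residue_degree w F E <= degree F E)%N.
Proof.
have [t [Et it _]] := ram_transversal.
have [q [Eq _ iq]] := finite_extP (residues_subfield w hF) residues_finite.
by have := fundamental_le Et it Eq iq; rewrite !card_ord.
Qed.

Lemma ram_le (I : finType) (t : I -> G) : (forall i, vg E (t i)) ->
  incongruent (vg F) t -> (#|I| <= ram_index w F E)%N.
Proof.
have [u hu] := ram_transversal.
by move=> Et it; have := transversal_le (vg_subgroup w hF) hu Et it; rewrite card_ord.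
Qed.

Lemma ram_mulrn g : vg E g -> vg F (g *+ ram_index w F E).
Proof.
have [t ht] := ram_transversal.
have := transversal_mulrn (vg_subgroup w hF) (vg_subgroup w hE) ht (g := g).
by rewrite card_ord.
Qed.

(** Positivity of both indices makes the factor [d] unique, and the default 0 of [defect] is
    different from 1. *)
Lemma defectlessP :
  defectless w F E <-> degree F E = (ram_index w F E * residue_degree w F E)%N.
Proof.
rewrite /defectless /defect; split=> [|e].
  by case: xgetP => [d _ /= -> ->|//]; rewrite muln1.
case: xgetP => [d _ /=|/(_ 1%N)[]]; last by rewrite /= muln1.
rewrite e -[LHS]muln1 => /eqP; rewrite eqn_pmul2l; first by move/eqP.
by rewrite muln_gt0 ram_gt0 resdeg_gt0.
Qed.

(** The independent family behind the fundamental inequality has as many members as the degree, so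
    it is a basis. *)
Lemma defectless_vbasis : defectless w F E ->
  exists (I : finType) (e : I -> L), fbasis F E e /\ vindep w F e.
Proof.
move/defectlessP => de; have [t [Et it _]] := ram_transversal.
have [q [Eq _ iq]] := finite_extP (residues_subfield w hF) residues_finite.
have [e [Ee ie ve ce]] := vindep_family Et it Eq iq.
exists _, e; split=> //; apply: indep_basis => //.
by rewrite ce de !card_ord.
Qed.

(* In a valuation independent basis, killing a coordinate in which the
   valuation of 1 is attained gives a best approximation. *)
Lemma best_approximation b : defectless w F E -> E b ->
  exists2 z, F z & forall z', F z' -> w (b - z') <= w (b - z).
Proof.
move=> /defectless_vbasis[I [e [[Ee se ie] ve]]] Eb.
have [c Fc bE] := se b Eb; have [a Fa aE] := se 1 (subf1 hE).
have [k wk] : exists k, w (a k * e k) <= vzero G.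
  apply: contrapT => nk; suff : vzero G < w 1 by rewrite Defs.val1 ltxx.
  rewrite aE; apply: w_sum_gt => // k _.
  by rewrite ltNge; apply/negP => h; apply: nk; exists k.
have ak : a k != 0.
  by apply: contraTneq wk => ->; rewrite mul0r Defs.val0.
have Fz : F (c k / a k) by apply: subfV2.
exists (c k / a k) => // z' Fz'; set z := c k / a k.
(* Coordinate [k] of [b - z'] contributes [a k * e k * (z - z')], where [a k * e k] has value at
   most 0. *)
have le : w (b - z') <= w (z - z').
  have -> : b - z' = \sum_i (c i - z' * a i) * e i.
    rewrite (eq_bigr (fun i => c i * e i - z' * (a i * e i))); last first.
      by move=> i _; rewrite mulrBl mulrA.
    by rewrite sumrB -mulr_sumr -aE -bE mulr1.
  apply: le_trans (ve _ _ k) _.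
    by move=> i; apply: subfB => //; apply: subfM.
  have -> : (c k - z' * a k) * e k = a k * e k * (z - z').
    by rewrite mulrAC mulrBr /z [a k * (_ / _)]mulrC divfK // [a k * z']mulrC.
  have [->|zz] := eqVneq (z - z') 0; first by rewrite mulr0.
  by rewrite -[X in _ <= w X]mul1r w_leM // Defs.val1.
by have := wB_ge (lexx _) le; rewrite opprB addrA subrK.
Qed.

End FundamentalInequality.

Section Towers.
Variables (L : fieldType) (G : ogroupType) (w : valuation L G).
Variables (F E' E : set L).
Hypotheses (hF : is_subfield F) (hE' : is_subfield E') (hE : is_subfield E).
Hypotheses (sF : F `<=` E') (sE : E' `<=` E) (fin : finite_ext F E).

Let fin1 : finite_ext F E'. Proof. exact: finite_sub fin sE. Qed.
Let fin2 : finite_ext E' E. Proof. exact: finite_over fin. Qed.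

Lemma ram_tower :
  ram_index w F E = (ram_index w F E' * ram_index w E' E)%N.
Proof.
have [t ht] := ram_transversal w hE' hE fin2.
have [u hu] := ram_transversal w hF hE' fin1.
have h := transversal_mul (vg_subgroup w hF) (vg_subgroup w hE')
  (vg_subgroup w hE) (vg_sub (w := w) sF) (vg_sub (w := w) sE) ht hu.
by rewrite (ramE hF h) card_prod !card_ord mulnC.
Qed.

Lemma residue_degree_tower :
  residue_degree w F E = (residue_degree w F E' * residue_degree w E' E)%N.
Proof.
apply: degree_tower (residues_finite w hF hE fin).
- exact: residues_subfield.
- exact: residues_subfield.
- exact: residues_subfield.
- exact: residues_sub.
- exact: residues_sub.
Qed.

(** Equality in a product of two inequalities between positive integers forces equality in each. *)
Lemma defectless_tower : defectless w F E ->
  defectless w F E' /\ defectless w E' E.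
Proof.
move=> /(defectlessP w hF hE fin); rewrite (degree_tower hF hE' hE sF sE fin).
rewrite ram_tower residue_degree_tower mulnACA => e.
have le1 := fundamental_inequality w hF hE' fin1.
have le2 := fundamental_inequality w hE' hE fin2.
have d1 := degree_gt0 hF hE' fin1; have d2 := degree_gt0 hE' hE fin2.
have e1 := ram_gt0 w hF hE' fin1; have e2 := ram_gt0 w hE' hE fin2.
have f1 := resdeg_gt0 w hF hE' fin1; have f2 := resdeg_gt0 w hE' hE fin2.
split; [apply/(defectlessP w hF hE' fin1)|apply/(defectlessP w hE' hE fin2)]; apply/eqP.
  rewrite eqn_leq le1 andbT -(leq_pmul2r d2) e leq_mul2l le2 orbT //.
by rewrite eqn_leq le2 andbT -(leq_pmul2l d1) e leq_mul2r le1 orbT.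
Qed.

End Towers.

(** * Conjugates over a henselian field *)

Section CharExponent.
Variable k : fieldType.

Lemma char_exponentE p : p \in [pchar k] -> char_exponent k = p.
Proof.
move=> pk; rewrite /char_exponent; case: xgetP => [p' _ /= p'k|/(_ p)//].
by apply/eqP; have := pcharf_eq pk p'; rewrite p'k => /esym.
Qed.

Lemma coprime_char_exponent e q : coprime e (char_exponent k) ->
  [pchar k].-nat q -> coprime e q.
Proof.
move=> ce hq; have [->|q1] := eqVneq q 1%N; first exact: coprimen1.
have [p pk] : exists p, p \in [pchar k].
  exists (pdiv q); case/andP: hq => q0 /allP; apply.
  rewrite mem_primes pdiv_prime ?q0 ?pdiv_dvd //.
  by case: (q) q0 q1 => [|[]].
rewrite (char_exponentE pk) in ce.
have : p.-nat q by rewrite -(eq_pnat _ (pcharf_eq pk)).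
by move=> /p_natP[j ->]; apply: coprimeXr.
Qed.

Lemma coprime_char_exponentP e :
  (forall p, p \in [pchar k] -> ~~ (p %| e)%N) -> coprime e (char_exponent k).
Proof.
move=> h; rewrite /char_exponent; case: xgetP => [p _ /= pk|_]; last exact: coprimen1.
by rewrite coprime_sym prime_coprime ?h // (pcharf_prime pk).
Qed.

End CharExponent.

Section ResiduePolynomials.
Variables (L : fieldType) (G : ogroupType) (w : valuation L G).
Local Notation res := (residue w).

Lemma nat_int n : vzero G <= w n%:R.
Proof.
elim: n => [|n IH]; first by rewrite Defs.val0.
by rewrite -natr1; apply: wD_ge => //; rewrite Defs.val1.
Qed.

Lemma res_nat n : res n%:R = n%:R.
Proof.
elim: n => [|n IH]; first exact: res0.
by rewrite -!natr1 resD ?nat_int ?Defs.val1 // IH res1.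
Qed.

(** Reduction modulo the maximal ideal, stated per coefficient because [residue] cannot be mapped
    over polynomials as a morphism. *)
Lemma coef_res_prod_XsubC (s : seq L) : (forall x, x \in s -> vzero G <= w x) ->
  forall j, vzero G <= w (\prod_(x <- s) ('X - x%:P))`_j /\
    res (\prod_(x <- s) ('X - x%:P))`_j = (\prod_(x <- s) ('X - (res x)%:P))`_j.
Proof.
elim: s => [|a s IH] hs j.
  rewrite !big_nil !coefC; case: (j == 0)%N; first by rewrite Defs.val1 res1.
  by rewrite Defs.val0 res0.
have a0 : vzero G <= w a by apply: hs; apply: mem_head.
have {}IH := IH (fun x xs => hs x (mem_behead (s := a :: s) xs)).
rewrite !big_cons !mulrBl !coefB !coefXM !coefCM.
set P := \prod_(x <- s) _ in IH *; set Q := \prod_(x <- s) _ in IH *.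
have [hj ej] := IH j; have [hj' ej'] := IH j.-1.
have aj : vzero G <= w (a * P`_j) by apply: wM_ge0.
have e : res (a * P`_j) = res a * Q`_j by rewrite resM // ej.
case: eqP => _; split.
- by rewrite wB_ge // Defs.val0.
- by rewrite resB ?Defs.val0 // res0 e.
- exact: wB_ge.
- by rewrite resB // ej' e.
Qed.

(** Coefficients of the substitution of [b X] for [X], which turns each root [x] into [x / b]. *)
Lemma coef_scale_prod_XsubC (s : seq L) b j : b != 0 ->
  (\prod_(x <- s) ('X - x%:P))`_j * b ^+ j =
  b ^+ size s * (\prod_(x <- s) ('X - (x / b)%:P))`_j.
Proof.
move=> b0; elim: s j => [|a s IH] j.
  rewrite !big_nil !coefC; case: j => [|j] /=; first by rewrite !expr0.
  by rewrite mul0r mulr0.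
rewrite !big_cons !mulrBl !coefB !coefXM !coefCM /=.
case: j => [|j] /=.
  rewrite !sub0r mulNr mulrN -[a * _ * _]mulrA IH exprS.
  by field.
rewrite mulrBl -[a * _ * _]mulrA IH [b ^+ j.+1]exprS mulrCA IH [b ^+ _.+1]exprS.
by field.
Qed.

(* The conjugates are all congruent to [b], so modulo the maximal ideal the
   polynomial is [(X - b)^(q m)] with [m] a unit, and the coefficient of degree
   [q (m - 1)] recovers [b ^ q]. *)
Lemma close_conjugates_pow (E : set L) (s : seq L) b : is_subfield E ->
  s != [::] -> b != 0 -> (forall x, x \in s -> w b < w (x - b)) ->
  pover E (\prod_(x <- s) ('X - x%:P)) ->
  exists q y, [/\ [pchar residue_field w].-nat q, E y
    & w (b ^+ q) < w (b ^+ q - y)].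
Proof.
move=> hE s0 b0 hs Es; set N := size s.
have N0 : (0 < N)%N by rewrite /N lt0n size_eq0.
(* The [p]-part of [N] and its prime-to-[p] part; in residue characteristic 0 this reads [q = 1],
   [m = N]. *)
pose q := (N`_[pchar residue_field w])%N; pose m := (N`_([pchar residue_field w]^'))%N.
have Nqm : N = (q * m)%N by rewrite partnC.
have hq : [pchar residue_field w].-nat q by apply: part_pnat.
have m0 : m%:R != 0 :> residue_field w by rewrite natf_neq0_pchar part_pnat.
have m_gt0 : (0 < m)%N by apply: part_gt0.
have q_gt0 : (0 < q)%N by apply: part_gt0.
pose j := (q * m.-1)%N.
have Nj : N = (j + q)%N by rewrite /j addnC -mulnS prednK.
pose s1 := [seq x / b | x <- s].
have hs1 x : x \in s1 -> vzero G < w (x - 1).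
  case/mapP => y ys ->; rewrite -(divff b0) -mulrBl -w_lt_div //; exact: hs.
have is1 x : x \in s1 -> vzero G <= w x.
  move=> /hs1/ltW h; rewrite -[x](subrK 1); apply: wD_ge => //.
  by rewrite Defs.val1.
have rs1 x : x \in s1 -> res x = 1.
  by move=> xs; apply/eqP; rewrite -(res1 w) res_eq ?Defs.val1 ?(hs1 x) ?(is1 x).
pose kap := (\prod_(x <- s1) ('X - x%:P))`_j.
have [kint kres] := coef_res_prod_XsubC is1 j.
(* The reduced polynomial is [(X - 1)^(q m) = (X^q - 1)^m], whose coefficient of degree [q (m - 1)]
   is [-m]. *)
have {}kres : res kap = - m%:R.
  rewrite kres (eq_big_seq (fun=> 'X - 1%:P)) => [|x xs]; last first.
    by rewrite rs1.
  rewrite big_map big_const_seq count_predT iter_mulr_1 -/N Nqm exprM.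
  rewrite expXsubC_pchar // expr1n.
  have -> : ('X^q - 1%:P) ^+ m = ('X - 1%:P) ^+ m \Po 'X^q :> {poly residue_field w}.
    by rewrite rmorphXn rmorphB /= comp_polyX comp_polyC.
  rewrite coef_comp_poly_Xn // /j dvdn_mulr // mulKn //.
  have := @coefPn_prod_XsubC _ (nseq m (1 : residue_field w)).
  rewrite size_nseq !big_nseq iter_mulr_1 iter_addr_0 => -> //.
  by rewrite -lt0n.
pose P := \prod_(x <- s) ('X - x%:P).
have Pj : P`_j = b ^+ q * kap.
  apply: (mulIf (expf_neq0 j b0)); rewrite coef_scale_prod_XsubC // -/N.
  by rewrite /kap big_map {1}Nj exprD -mulrA mulrC.
have wm : w (- m%:R) = vzero G.
  apply/eqP; rewrite Defs.valN -res_unit ?nat_int // res_nat //.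
have m0' := w_unit_neq0 wm.
(* [P_j = b^q kap] with [kap] congruent to the unit [-m]. *)
exists q, (P`_j / - m%:R); split=> //.
  apply: (subfV2 hE (Es j)); apply: (subfN hE); exact: subf_nat.
have -> : b ^+ q - P`_j / - m%:R = (1 - kap / - m%:R) * b ^+ q.
  by rewrite Pj mulrBl mul1r -mulrA mulrC.
rewrite -[X in w X < _]mul1r w_ltM ?expf_neq0 // Defs.val1.
have kint' : vzero G <= w (kap / - m%:R) by rewrite wM_ge0 // w_unitV.
rewrite -res_eq ?Defs.val1 // res1 resM ?w_unitV // resV // kres resN ?nat_int // res_nat.
by rewrite divff // oppr_eq0.
Qed.

End ResiduePolynomials.

Section HenselianInvariance.
Variables (K : fieldType) (GK : ogroupType) (v : valuation K GK).
Variables (L : closedFieldType) (iota : {rmorphism K -> L}).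
Variables (G : ogroupType) (w : valuation L G).

Lemma range_subfield : is_subfield (range iota).
Proof.
apply: is_subfieldP; split.
- by exists 1; rewrite ?rmorph1.
- by move=> _ _ [x _ <-] [y _ <-]; exists (x - y); rewrite ?rmorphB.
- by move=> _ _ [x _ <-] [y _ <-]; exists (x / y); rewrite ?fmorph_div.
Qed.

Lemma range_algebraic : is_algebraic_closure iota ->
  forall x, algebraic_over (range iota) x.
Proof.
move=> h x; have [p p0 px] := h x; exists (map_poly iota p); split=> //.
  by rewrite map_poly_eq0.
by move=> i; rewrite coef_map; exists p`_i.
Qed.

Lemma comp_valuation (s : {rmorphism L -> L}) :
  exists ws : valuation L G, forall x, ws x = w (s x).
Proof.
have h0 x : w (s x) = None <-> x = 0.
  split=> [/valE0/eqP|->]; last by rewrite rmorph0 Defs.val0.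
  by rewrite fmorph_eq0 => /eqP.
have hM x y : w (s (x * y)) = vadd (w (s x)) (w (s y)) by rewrite rmorphM Defs.valM.
have hD x y : Num.min (w (s x)) (w (s y)) <= w (s (x + y)) by rewrite rmorphD Defs.valD.
by exists (Valuation h0 hM hD).
Qed.

(* If [w (s x)] were larger than [w x], the valuation would increase strictly
   along the orbit of [x], which is finite. *)
Lemma henselian_fixes : henselian v -> is_algebraic_closure iota ->
  extends iota v w -> forall s : {rmorphism L -> L}, fixes (range iota) s ->
  forall x, w (s x) = w x.
Proof.
move=> hens clo ext s hs.
have [ws hws] := comp_valuation s.
(* Henselianity identifies only the valuation rings of [w] and of [w] composed with [s]; equality of
   values still has to be derived. *)
have int x : (vzero G <= w (s x)) = (vzero G <= w x).
  rewrite -hws; apply/esym; apply: (hens L iota clo G G w ws ext _ x).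
  by move=> y; rewrite hws hs; [apply: ext|exists y].
have pos x : vzero G < w x -> vzero G < w (s x).
  have [->|x0] := eqVneq x 0; first by rewrite rmorph0.
  have sx0 : s x != 0 by rewrite fmorph_eq0.
  have inv y : y != 0 -> (vzero G < w y) = ~~ (vzero G <= w y^-1).
    by move=> y0; rewrite ltNge -{1}(Defs.val1 w) w_le_div // mul1r.
  by rewrite !inv // -fmorphV int.
have nlt x : w x < w (s x) -> False.
  move=> lt; have x0 : x != 0.
    by rewrite -(wNone w); apply: contraTneq lt => ->; rewrite ltNge vle_None.
  have up y z : y != 0 -> w y < w z -> w (s y) < w (s z).
    by move=> y0; rewrite !w_lt_div ?fmorph_eq0 // -fmorph_div; apply: pos.
  pose f i := iter i s x.
  have f0 i : f i != 0 by elim: i => //= i IH; rewrite fmorph_eq0.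
  have fS i : w (f i) < w (f i.+1).
    by elim: i => // i IH; apply: up IH; apply: f0.
  have fmono i j : (i < j)%N -> w (f i) < w (f j).
    elim: j => // j IH; rewrite ltnS leq_eqVlt => /orP[/eqP->|/IH h]; first exact: fS.
    exact: lt_trans h (fS j).
  have hF := range_subfield; have alg := range_algebraic clo.
  have [q hq] := minpoly_ex hF (alg x).
  (* One iterate more than the degree of [q], which is too many distinct roots. *)
  pose t := mkseq f (size q).
  have rt : all (root q) t.
    apply/allP => _ /mapP[i _ ->]; elim: i => [|i IH]; first exact: minpoly_root hq.
    exact: (fixes_root hs (minpoly_over hF hq) IH).
  have ut : uniq t.
    apply: mkseq_uniq => i j e; apply/eqP; rewrite eqn_leq.
    by apply/andP; split; rewrite leqNgt; apply/negP => /fmono; rewrite e ltxx.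
  have := max_poly_roots (minpoly_neq0 hq) rt ut.
  by rewrite size_mkseq ltnn.
move=> x; have [->|x0] := eqVneq x 0; first by rewrite rmorph0.
apply/eqP; rewrite eq_le !leNgt; apply/andP; split; apply/negP => lt; last first.
  apply: (nlt x^-1); rewrite fmorphV.
  rewrite w_lt_div ?invr_eq0 // invrK mulrC -w_lt_div ?fmorph_eq0 //.
exact: (nlt x).
Qed.

End HenselianInvariance.

(** * Distinguished pairs in tame extensions *)

Section SetMax.
Variable G : ogroupType.

Lemma set_maxE (S : set (with_infty G)) m :
  S m -> (forall s, S s -> s <= m) -> set_max S = m.
Proof.
move=> Sm hm; rewrite /set_max; case: xgetP => [m' _ [Sm' hm']|/(_ m)[]//].
by apply/le_anti; rewrite hm // hm'.
Qed.

(** A finite value is not the default infinity, so it is a true maximum. This is how an equality of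
    [omega] with the finite [delta] becomes a bound on the Krasner set. *)
Lemma set_max_Some (S : set (with_infty G)) g : set_max S = Some g ->
  S (Some g) /\ forall s, S s -> s <= Some g.
Proof. by rewrite /set_max; case: xgetP => // m _ h <-. Qed.

Lemma exists_max_seq (T : eqType) (f : T -> with_infty G) (s : seq T) :
  s != [::] -> exists2 x, x \in s & forall y, y \in s -> f y <= f x.
Proof.
elim: s => // a s IH _; have [->|/IH[x xs hx]] := eqVneq s [::].
  by exists a; rewrite ?mem_head // => y; rewrite inE => /eqP ->.
have [le|lt] := leP (f x) (f a).
  exists a; rewrite ?mem_head // => y; rewrite inE => /orP[/eqP->//|/hx h].
  exact: le_trans h le.
exists x; rewrite ?inE ?xs ?orbT // => y; rewrite inE => /orP[/eqP->|/hx //].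
exact: ltW.
Qed.

End SetMax.

(** A Bezout relation between [n] and [m] expresses [g] through the two multiples. *)
Lemma subgroup_coprime (G : zmodType) (A : set G) g n m : is_subgroup A ->
  coprime n m -> (0 < n)%N -> A (g *+ n) -> A (g *+ m) -> A g.
Proof.
move=> hA cnm n0 An Am.
have mul h i : A h -> A (h *+ i).
  move=> Ah; elim: i => [|i IH]; first by case: hA.
  by rewrite mulrS; apply: subgroupD.
have [i j e _] := egcdnP m n0.
have := cnm; rewrite /coprime => /eqP c1; rewrite c1 in e.
have -> : g = g *+ n *+ i - g *+ m *+ j.
  by rewrite -!mulrnA ![(_ * i)%N]mulnC ![(_ * j)%N]mulnC e mulrnDr addrC addKr.
by apply: (proj2 hA); apply: mul.
Qed.

Section TameStep.
Variables (L : closedFieldType) (G : ogroupType) (w : valuation L G).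
Variables (F : set L) (hF : is_subfield F) (alg : forall x, algebraic_over F x).
Hypothesis hw : forall s : {rmorphism L -> L}, fixes F s ->
  forall x, w (s x) = w x.
Local Notation rs E := (@residues _ _ w E).

Lemma krasner_setP b x : krasner_set w F b x <->
  exists s : {rmorphism L -> L}, [/\ fixes F s, s b <> b & x = w (b - s b)].
Proof.
split=> [[b' [/(conjugate_embedding hF alg)[s hs sb] nb] <-]|[s [hs sb ->]]].
  by exists s; rewrite sb.
by exists (s b) => //; split=> //; apply: fixes_conjugate.
Qed.

Lemma deg_gt0 b : (0 < deg F b)%N.
Proof.
apply: degree_gt0 => //; first exact: adjoin_subfield.
by apply: adjoin_finite.
Qed.

Lemma deg_adjoin_le b c : adjoin F c b -> (deg F b <= deg F c)%N.
Proof.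
move=> cb; apply: degree_le => //; first exact: adjoin_finite.
by apply: adjoin_min => //; [apply: adjoin_subfield|apply: sub_adjoin].
Qed.

Section Step.
Variables (b c : L).
Hypotheses (sb : separable_over F b) (dp : distinguished_pair w F b c).

Lemma dist_pair_delta : delta w F b = w (b - c).
Proof.
case: dp => h1 h2 _; apply: set_maxE; first by exists c.
by move=> _ [z hz <-]; apply: h2.
Qed.

Hypothesis tm : tame w F (adjoin F b).

Lemma tame_step :
  [/\ krasner_set w F b (w (b - c)),
      forall x, krasner_set w F b x -> x <= w (b - c),
      forall s : {rmorphism L -> L}, fixes F s -> w (b - c) <= w (b - s b) -> s c = c
    & adjoin F c `<` adjoin F b].
Proof.
have [degc maxc minc] := dp.
set Fb := adjoin F b; set Fc := adjoin F c.
have hFb : is_subfield Fb by apply: adjoin_subfield.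
have hFc : is_subfield Fc by apply: adjoin_subfield.
have sFb : F `<=` Fb by apply: sub_adjoin.
have sFc : F `<=` Fc by apply: sub_adjoin.
have finb : finite_ext F Fb by apply: adjoin_finite.
have algb x : algebraic_over Fb x by apply: (algebraic_over_sub sFb).
have algc x : algebraic_over Fc x by apply: (algebraic_over_sub sFc).
have bb : Fb b by apply: mem_adjoin.
have [r ur hr] := sep_roots hF sb.
have br : b \in r := conj_self hr.
pose r' := [seq x <- r | x != b].
(* The degree of [b] exceeds that of [c], so the separable [b] has another conjugate. *)
have r'0 : r' != [::].
  apply/eqP => r'0; have : perm_eq r (b :: r').
    apply: uniq_perm => //=.
      by rewrite filter_uniq // mem_filter eqxx.
    by move=> x; rewrite inE mem_filter; case: eqP => // ->.
  move/perm_size; rewrite r'0 (conj_size hF hr) => e.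
  by have := deg_gt0 c; move: degc; rewrite e ltnS leqn0 => /eqP ->.
have [x1] := exists_max_seq (fun x => w (b - x)) r'0.
rewrite mem_filter => /andP[x1b x1r] maxx1; set om := w (b - x1) in maxx1.
have maxom (s : {rmorphism L -> L}) : fixes F s -> s b <> b -> w (b - s b) <= om.
  move=> hs sbb; apply: maxx1; rewrite mem_filter (conj_mem hF hr hs) andbT.
  exact/eqP.
(* [E'] plays the role of [F(c)]: it is the fixed field of the stabiliser [H']
   of the ball of radius [om] around [b]. *)
pose H' : set {rmorphism L -> L} := [set s | fixes F s /\ om <= w (b - s b)].
pose E' : set L := [set x | Fb x /\ forall s, H' s -> s x = x].
have hE' : is_subfield E'.
  apply: is_subfieldP; split.
  - by split=> [|s _]; [apply: (subf1 hFb)|rewrite rmorph1].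
  - move=> x y [bx hx] [by_ hy]; split=> [|s Hs]; first exact: (subfB hFb).
    by rewrite rmorphB hx ?hy.
  - move=> x y [bx hx] [by_ hy]; split=> [|s Hs]; first exact: (subfV2 hFb).
    by rewrite fmorph_div hx ?hy.
have sFE : F `<=` E'.
  by move=> x Fx; split=> [|s [hs _]]; [apply: sFb|apply: hs].
have sEb : E' `<=` Fb by move=> x [].
have nE'b : ~ E' b.
  have [s1 hs1 s1b] := conj_ex hF alg hr x1r.
  move=> [_ /(_ s1)]; rewrite s1b => h; case/eqP: x1b; apply: h.
  by split=> //; rewrite s1b.
pose B := [seq x <- r | om <= w (b - x)].
have bB : b \in B by rewrite mem_filter br subrr Defs.val0 vle_None.
have uB : uniq B by apply: filter_uniq.
have stB s : H' s -> forall x, x \in B -> s x \in B.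
  move=> [hs hsb] x; rewrite !mem_filter => /andP[hx xr].
  rewrite (conj_stable hF hr hs xr) andbT; apply: (w_dist hsb).
  by rewrite -rmorphB hw.
(* The coefficients lie in [F(b)] by descent, as [F(b)]-endomorphisms belong to [H']; they are fixed
   by [H'], which permutes [B]. *)
have E'B : pover E' (\prod_(x <- B) ('X - x%:P)).
  move=> i; split=> [|s Hs].
    apply: (stable_prod_over hFb algb uB) => [x|s x hs].
      rewrite mem_filter => /andP[_ xr]; apply: (sep_sub hF hFb sFb).
      apply: (sep_of_poly hF (minpoly_over hF hr)).
        by rewrite separable_prod_XsubC.
      by rewrite root_prod_XsubC.
    apply: stB; split; first exact: fixes_sub hs.
    by rewrite hs // subrr Defs.val0 vle_None.
  by rewrite -coef_map (stable_prod_map uB (stB s Hs)).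
have [_ _ defb] := tm hFb sFb (@subset_refl _ _) finb.
have [copF sepF _] := tm hFb sFb (@subset_refl _ _) finb.
have [_ defE] := defectless_tower hF hE' hFb sFE sEb finb defb.
have finE := finite_over hF hE' sFE finb.
have [z0 E'z0 best] := best_approximation hE' hFb finE defE bb.
(* Otherwise all [E']-conjugates of [beta = b - z0] are congruent to [beta], so
   a [q]-th power of [beta] is congruent to an element of [E'], and tameness
   turns this into an approximation of [beta] itself, improving [z0]. *)
have le0 : om <= w (b - z0).
  rewrite leNgt; apply/negP => lt; set beta := b - z0 in lt best.
  have beta0 : beta != 0.
    by apply: contraTneq lt => ->; rewrite Defs.val0 ltNge vle_None.
  have Fbeta : Fb beta by apply: (subfB hFb) => //; apply: sEb.
  pose B' := [seq x - z0 | x <- B].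
  have B'0 : B' != [::].
    by rewrite -size_eq0 size_map size_eq0; apply/eqP => B0; rewrite B0 in bB.
  have E'B' : pover E' (\prod_(x <- B') ('X - x%:P)).
    have -> : \prod_(x <- B') ('X - x%:P) =
        (\prod_(x <- B) ('X - x%:P)) \Po ('X + z0%:P).
      rewrite rmorph_prod big_map; apply: eq_bigr => x _.
      by rewrite /= comp_polyB comp_polyX comp_polyC polyCB opprB addrA.
    apply: pover_comp => //; apply: poverD => //; first exact: poverX.
    exact: poverC.
  have cl x : x \in B' -> w beta < w (x - beta).
    case/mapP => y; rewrite mem_filter => /andP[hy _] ->.
    apply: (lt_le_trans lt); rewrite /beta opprB addrA subrK wBC.
    exact: hy.
  have [q [y [hq E'y wy]]] := close_conjugates_pow hE' B'0 beta0 cl E'B'.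
  have [g gE] := wSome w beta0.
  (* Modulo [vE'], the value [g] of [beta] is killed by the ramification index of [F(b)] over [E']
     and, through [y], by [q]; these are coprime. *)
  have vge : value_group w E' g.
    have c1 : coprime (ram_index w E' Fb) q.
      apply: coprime_char_exponent hq.
      move: copF; rewrite (ram_tower w hF hE' hFb sFE sEb finb) coprimeMl.
      by case/andP.
    have wX x h n : w x = Some h -> w (x ^+ n) = Some (h *+ n).
      move=> xh; elim: n => [|n IH]; first by rewrite expr0 Defs.val1.
      by rewrite exprS Defs.valM xh IH mulrS.
    apply: (subgroup_coprime (vg_subgroup w hE') c1).
    - exact: ram_gt0.
    - by apply: ram_mulrn => //; exists beta.
    exists y => //; rewrite -(wX _ _ q gE).
    by rewrite -(wB_lt wy) addrAC subrr sub0r Defs.valN.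
  have [d E'd wd] := vge.
  have d0 : d != 0 by rewrite -(wNone w) wd.
  have wu : w (beta / d) = vzero G.
    by apply/eqP; rewrite -w_eq_div // gE wd.
  have ui : vzero G <= w (beta / d) by rewrite wu.
  set rb := residue w (beta / d).
  have rq : rs E' (rb ^+ q).
    have dq0 : d ^+ q != 0 by rewrite expf_neq0.
    have h : vzero G < w ((beta / d) ^+ q - y / d ^+ q).
      rewrite expr_div_n -mulrBl -w_lt_div //.
      suff <- : w (beta ^+ q) = w (d ^+ q) by [].
      by apply: w_congX; rewrite gE wd.
    have uq : vzero G <= w ((beta / d) ^+ q) by apply: wX_ge0.
    have yi : vzero G <= w (y / d ^+ q).
      rewrite -[y / _](subKr ((beta / d) ^+ q)); apply: wB_ge => //.
      exact: ltW.
    apply/residuesP; exists (y / d ^+ q); split=> //.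
      by apply: (subfV2 hE') => //; apply: (subfX hE').
    by apply/eqP; rewrite -resX // eq_sym res_eq.
  have rsep : separable_over (rs E') rb.
    apply: (sep_sub (residues_subfield w hF) (residues_subfield w hE')).
      exact: residues_sub.
    apply: sepF; apply/residuesP; exists (beta / d); split=> //.
    by apply: (subfV2 hFb) => //; apply: sEb.
  (* [rb] is separable over [E'v] and its [q]-th power lies there, with [q] a power of the residue
     characteristic. *)
  have rE' : rs E' rb.
    have hR := residues_subfield w hE'.
    apply: (adjoin_min hR (@subset_refl _ _) rq).
    exact: sep_mem_adjoin_pow.
  (* A lift [z1] of [rb] in [E'] makes [d * z1] agree with [beta] to leading order, so [z0 + d * z1]
     is closer to [b] than [z0]. *)
  have [z1 [E'z1 z1i z1E]] := (residuesP _ _).1 rE'.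
  have lt1 : vzero G < w (beta / d - z1) by rewrite -res_eq // z1E.
  have E'z : E' (z0 + d * z1) by apply: (subfD hE') => //; apply: (subfM hE').
  have := best _ E'z; rewrite leNgt => /negP; apply.
  have -> : b - (z0 + d * z1) = (beta / d - z1) * d.
    by rewrite mulrBl divfK // /beta opprD addrA [z1 * d]mulrC.
  suff -> : w beta = w d.
    by rewrite -[X in w X < _]mul1r w_ltM // Defs.val1.
  by rewrite gE wd.
have degz : (degree F E' < deg F b)%N.
  rewrite ltnNge; apply/negP => le; apply: nE'b.
  by rewrite -(degree_eq hF hE' sFE sEb finb le).
have degz0 : (deg F z0 <= degree F E')%N.
  apply: degree_le => //; first exact: finite_sub finb sEb.
  exact: adjoin_min.
(* [w (b - c) <= om] is Krasner's lemma. *)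
have omc : w (b - c) = om.
  apply/le_anti; apply/andP; split; last first.
    apply: (le_trans le0); apply: maxc; exact: (leq_ltn_trans degz0 degz).
  rewrite leNgt; apply/negP => lt.
  have Fcb : Fc b.
    apply: (sep_fixed_mem hFc algc (sep_sub hF hFc sFc sb)) => s hs.
    have hsF := fixes_sub sFc hs.
    apply: contrapT => sbb; have := maxom s hsF sbb.
    rewrite leNgt => /negP; apply; apply: (lt_le_trans lt).
    apply: (w_dist (lexx _)).
    have sc : s c = c by apply: hs; apply: mem_adjoin.
    by rewrite -{2}sc -rmorphB hw // wBC.
  by have := deg_adjoin_le Fcb; rewrite leqNgt degc.
(* An endomorphism fixing [c] moves [b] by at least [om], so it lies in [H'] and fixes [E'].
   Conversely [z0] also attains [w (b - c)], so minimality of [c] gives [deg F c <= deg F z0 <=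
   [E' : F]]. *)
have E'c : E' = Fc.
  have sEc : E' `<=` Fc.
    move=> x [bx hx].
    have cbx : adjoin Fc b x.
      apply: adjoin_min bx; first exact: adjoin_subfield.
        by move=> y Fy; apply: sub_adjoin; apply: sFc.
      exact: mem_adjoin.
    apply: (fixed_mem hFc algc (sep_sub hF hFc sFc sb) cbx) => s hs.
    have hsF := fixes_sub sFc hs; apply: hx; split=> //.
    rewrite -omc; apply: (w_dist (lexx _)).
    have sc : s c = c by apply: hs; apply: mem_adjoin.
    by rewrite -{2}sc -rmorphB hw // wBC.
  apply/esym; apply: (degree_eq hF hE' sFE sEc); first exact: adjoin_finite.
  apply: (leq_trans (minc z0 _) degz0).
  apply/le_anti; apply/andP; split; first by rewrite omc.
  by apply: maxc; exact: (leq_ltn_trans degz0 degz).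
split.
- rewrite omc; apply/krasner_setP.
  have [s1 hs1 s1b] := conj_ex hF alg hr x1r.
  by exists s1; rewrite s1b; split=> //; apply/eqP.
- by move=> x /krasner_setP[s [hs sbb ->]]; rewrite omc; apply: maxom.
- move=> s hs; rewrite omc => hsb.
  have [_ fixE] : E' c by rewrite E'c; apply: mem_adjoin.
  by apply: fixE.
split; first by rewrite -E'c.
by move=> /(_ b bb); rewrite -E'c.
Qed.

Lemma tame_krasner_step : krasner_set w F b = w (b - c) |` krasner_set w F c /\
  forall x, krasner_set w F c x -> x < w (b - c).
Proof.
have [kb maxb fixc _] := tame_step.
have far (s : {rmorphism L -> L}) : fixes F s -> s c <> c ->
    w (b - s b) < w (b - c) /\ w (c - s c) = w (b - s b).
  move=> hs sc; have lt : w (b - s b) < w (b - c).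
    by rewrite ltNge; apply/negP => /(fixc s hs).
  split=> //.
  have e : w (b - c) = w (s b - s c) by rewrite -rmorphB hw.
  (* The second summand has value at least [w (b - c)], hence more than the first. *)
  have -> : c - s c = (b - s b) + ((s b - s c) - (b - c)).
    by rewrite [in RHS]addrA; ring.
  by rewrite wD_lt //; apply: (lt_le_trans lt); apply: wB_ge; rewrite -?e.
split; last first.
  by move=> x /krasner_setP[s [hs sc ->]]; have [lt ->] := far s hs sc.
apply/seteqP; split=> [x /krasner_setP[s [hs sbb ->]]|x [->|/krasner_setP[s [hs sc ->]]]] //.
  have [sc|sc] := pselect (s c = c).
    left; apply/le_anti; rewrite maxb /=; last by apply/krasner_setP; exists s.
    apply: (w_dist (lexx _)); rewrite -{2}sc -rmorphB hw // wBC.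
    exact: lexx.
  by right; apply/krasner_setP; exists s; split=> //; have [_ ->] := far s hs sc.
have [lt ->] := far s hs sc; apply/krasner_setP; exists s; split=> // sbb.
by move: lt; rewrite sbb subrr Defs.val0 ltNge vle_None.
Qed.

End Step.
End TameStep.

(** * A criterion for tameness *)

Lemma size_le_fibres (T U : eqType) (g : T -> U) (m : nat) (d : seq U) (t : seq T) :
  {subset map g t <= d} -> (forall c, (size [seq x <- t | g x == c] <= m)%N) ->
  (size t <= m * size d)%N.
Proof.
elim: d t => [|c d IH] t sub fib.
  by case: t sub fib => // x t /(_ (g x)); rewrite mem_head => /(_ isT).
rewrite -(count_predC (fun x => g x == c)) mulnS leq_add //.
  by rewrite -size_filter.
rewrite -size_filter; apply: IH => [_ /mapP[x + ->]|c'].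
  rewrite mem_filter => /andP[/= gxc xt].
  by have := sub (g x) (map_f g xt); rewrite inE (negPf gxc).
apply: leq_trans (fib c'); rewrite !size_filter count_filter.
by apply: sub_count => x /andP[].
Qed.

Lemma exp_fibre_le (k : fieldType) (t : seq k) a n : (0 < n)%N -> uniq t ->
  (size [seq x <- t | x ^+ n == a] <= n)%N.
Proof.
move=> n0 ut.
have p0 : 'X^n - a%:P != 0 :> {poly k} by rewrite -size_poly_eq0 size_XnsubC.
have := max_poly_roots (rs := [seq x <- t | x ^+ n == a]) p0.
rewrite size_XnsubC // ltnS; apply; last exact: filter_uniq.
apply/allP => x; rewrite mem_filter => /andP[/eqP xa _].
by rewrite rootE !hornerE xa subrr.
Qed.

(** For [n = m p], injectivity of the Frobenius puts the fibre inside a fibre of the [m]-th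
    power. *)
Lemma exp_fibre_le_pchar (k : fieldType) (t : seq k) a n p : p \in [pchar k] ->
  (0 < n)%N -> (p %| n)%N -> uniq t ->
  (size [seq x <- t | x ^+ n == a] <= n %/ p)%N.
Proof.
move=> pk n0 /dvdnP[m nE] ut; have p0 := prime_gt0 (pcharf_prime pk).
rewrite nE mulnK //.
have m0 : (0 < m)%N by move: n0; rewrite nE muln_gt0 => /andP[].
case E : [seq x <- t | _] => [//|z r].
have zE : z ^+ (m * p) = a.
  have : z \in [seq x <- t | x ^+ (m * p) == a] by rewrite E mem_head.
  by rewrite mem_filter => /andP[/eqP].
rewrite -E; apply: leq_trans (exp_fibre_le (z ^+ m) m0 ut).
rewrite !size_filter; apply: sub_count => x /= /eqP xE.
have : (x ^+ m - z ^+ m) ^+ p = 0.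
  have hp : [pchar k].-nat p by rewrite pnatE // (pcharf_prime pk).
  by rewrite exprDn_pchar // exprNn_pchar // -!exprM xE zE subrr.
by move/eqP; rewrite expf_eq0 p0 subr_eq0.
Qed.

Section TameCriterion.
Variables (L : closedFieldType) (G : ogroupType) (w : valuation L G).
Variables (E : set L) (hE : is_subfield E) (alg : forall x, algebraic_over E x).
Hypothesis hw : forall s : {rmorphism L -> L}, fixes E s ->
  forall x, w (s x) = w x.
Local Notation rs E := (@residues _ _ w E).
Local Notation res := (residue w).

(** The action of [s] on residues fixes [Ev]; it is made concrete by lifting the coefficients of [q]
    to [E] and evaluating there. *)
Lemma residue_root_fixes (q : {poly residue_field w}) (s : {rmorphism L -> L}) u :
  fixes E s -> pover (rs E) q -> vzero G <= w u -> root q (res u) ->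
  root q (res (s u)).
Proof.
move=> hs hq ui.
have /choice[a ha] : forall i, exists x, [/\ E x, vzero G <= w x & res x = q`_i].
  by move=> i; apply/residuesP; apply: hq.
have ev v : vzero G <= w v -> q.[res v] = res (\sum_(i < size q) a i * v ^+ i).
  move=> vi; rewrite horner_coef res_sum => [|i]; last first.
    by apply: wM_ge0; [case: (ha i)|apply: wX_ge0].
  apply: eq_bigr => i _; have [_ ai <-] := ha i.
  by rewrite resM ?resX ?wX_ge0.
have int v : vzero G <= w v -> vzero G <= w (\sum_(i < size q) a i * v ^+ i).
  move=> vi; apply: w_sum_ge => i _.
  by apply: wM_ge0; [case: (ha i)|apply: wX_ge0].
rewrite !rootE !ev ?hw // !res_eq0 ?int ?hw //.
suff <- : s (\sum_(i < size q) a i * u ^+ i) = \sum_(i < size q) a i * s u ^+ i.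
  by rewrite hw.
rewrite rmorph_sum; apply: eq_bigr => i _.
by rewrite rmorphM rmorphXn hs //; case: (ha i).
Qed.

(* With [m = [E(y) : E]], the quotients [s y / y] have [m] distinct residues.
   Let [k] be the order of [w y] modulo [wE] and [u = y^k / d] a unit with
   [d] in [E]. The fibres of [k]-th power have at most [k] elements (at most
   [k / p] if [p] divides [k]), so [res u] has at least [m / k] distinct
   conjugates; the fundamental inequality forces equality everywhere. *)
Lemma separated_conjugates_tame y : separable_over E y -> y != 0 ->
  (forall s : {rmorphism L -> L}, fixes E s -> s y = y \/ w (s y - y) <= w y) ->
  coprime (ram_index w E (adjoin E y)) (char_exponent (residue_field w)) /\
  separable_ext (rs E) (rs (adjoin E y)).
Proof.
move=> sy y0 hy; set E1 := adjoin E y.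
have hE1 : is_subfield E1 by apply: adjoin_subfield.
have sE1 : E `<=` E1 by apply: sub_adjoin.
have fin : finite_ext E E1 by apply: adjoin_finite.
have hR := residues_subfield w hE; have hR1 := residues_subfield w hE1.
have yE1 : E1 y by apply: mem_adjoin.
have [r ur hr] := sep_roots hE sy.
have wr x : x \in r -> w x = w y.
  by move=> /(conj_ex hE alg hr)[s hs <-]; rewrite hw.
(* The hypothesis concerns pairs containing [y]; with [x = s y] and [x' = s z], the difference is
   the image of [y - z]. *)
have sepr x x' : x \in r -> x' \in r -> x != x' -> w (x - x') = w y.
  move=> xr x'r xx'; apply/le_anti; apply/andP; split; last first.
    by apply: wB_ge; rewrite (wr _ xr, wr _ x'r).
  have [s hs sx] := conj_ex hE alg hr xr.
  have : x' \in map s r.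
    by rewrite (perm_mem (stable_surj ur (fun z => conj_stable hE hr hs (x := z)))).
  case/mapP => z zr x'z; rewrite -sx x'z -rmorphB hw //.
  have [t ht tz] := conj_ex hE alg hr zr; rewrite wBC -tz.
  by case: (hy t ht) => // ty; case/eqP: xx'; rewrite -sx x'z -tz ty.
have [g gE] := wSome w y0.
have [k [k0 kg mink]] : exists k, [/\ (0 < k)%N, value_group w E (g *+ k)
    & forall j, (0 < j)%N -> value_group w E (g *+ j) -> (k <= j)%N].
  pose P j := (0 < j)%N && `[< value_group w E (g *+ j) >].
  have exP : exists j, P j.
    exists (ram_index w E E1); rewrite /P ram_gt0 //=; apply/asboolP.
    by apply: ram_mulrn => //; exists y.
  case: (ex_minnP exP) => k /andP[k0 /asboolP kg] mink; exists k; split=> // j j0 jg.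
  by apply: mink; rewrite /P j0; apply/asboolP.
have hV := vg_subgroup w hE.
have inc : incongruent (value_group w E) (fun i : 'I_k => g *+ i).
  move=> i j; wlog le : i j / (j <= i)%N.
    move=> h hij; have [le|le] := leqP j i; first exact: h.
    apply/esym/h; first exact: ltnW.
    by rewrite -opprB; apply: subgroupN.
  rewrite -mulrnBr // => hij; apply: val_inj => /=; apply/eqP; rewrite eqn_leq le andbT.
  rewrite leqNgt; apply/negP => lt.
  have := mink (i - j)%N; rewrite subn_gt0 => /(_ lt hij).
  by rewrite leqNgt (leq_ltn_trans (leq_subr _ _) (ltn_ord i)).
have incE1 (i : 'I_k) : value_group w E1 (g *+ i).
  exists (y ^+ i); first exact: (subfX hE1).
  elim: (val i) => [|j IH]; first by rewrite expr0 Defs.val1.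
  by rewrite exprS Defs.valM gE IH mulrS.
have [d Ed wd] := kg.
have wyk : w (y ^+ k) = w d.
  rewrite wd; elim: (k) => [|j IH]; first by rewrite expr0 Defs.val1.
  by rewrite exprS Defs.valM gE IH mulrS.
have d0 : d != 0 by rewrite -(wNone w) wd.
have wu : w (y ^+ k / d) = vzero G by apply/eqP; rewrite -w_eq_div // wyk.
have ui : vzero G <= w (y ^+ k / d) by rewrite wu.
set ub := res (y ^+ k / d).
have ub0 : ub != 0 by rewrite /ub res_unit ?wu.
have R1u : rs E1 ub.
  apply/residuesP; exists (y ^+ k / d); split=> //.
  by apply: (subfV2 hE1); [apply: (subfX hE1)|apply: sE1].
have finR := residues_finite w hE hE1 fin.
have [q hq] := minpoly_ex hR (finite_algebraic hR hR1 finR R1u).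
set f0 := (size q).-1.
have qf0 : size q = f0.+1.
  by rewrite prednK // ltnW // (minpoly_size_gt1 hq).
have [_ _ iu] := adjoin_fbasis hR hq.
have powR1 (j : 'I_f0) : rs E1 (ub ^+ j) by apply: (subfX hR1).
have m_ge : (k * f0 <= size r)%N.
  have := fundamental_le hE hE1 fin incE1 inc powR1 iu.
  by rewrite !card_ord (conj_size hE hr).
pose t := [seq res (x / y) | x <- r].
have wxy x : x \in r -> w (x / y) = vzero G.
  by move=> xr; apply/eqP; rewrite -w_eq_div // wr.
have ut : uniq t.
  rewrite map_inj_in_uniq // => x x' xr x'r /eqP.
  rewrite res_eq ?wxy // -mulrBl -w_lt_div // => lt.
  by apply/eqP; apply: contraTT lt => xx'; rewrite sepr // ltxx.
(* For [z = res (s y / y)] this is [res (s (y^k / d))], a root of [q]; the factor [ub] is nonzero,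
   so the fibres are those of the [k]-th power. *)
pose c z := z ^+ k * ub.
pose D := undup (map c t).
have uD : uniq D by apply: undup_uniq.
have rD : all (root q) D.
  apply/allP => z; rewrite mem_undup => /mapP[_ /mapP[x xr ->] ->].
  have [s hs sx] := conj_ex hE alg hr xr.
  have -> : c (res (x / y)) = res (s (y ^+ k / d)).
    rewrite /c -resX ?wxy // -resM //; last by rewrite wX_ge0 ?wxy.
    congr res; rewrite fmorph_div rmorphXn sx hs // expr_div_n.
    by rewrite mulrA divfK // expf_neq0.
  by apply: residue_root_fixes => //; [apply: (minpoly_over hR hq)|apply: (minpoly_root hq)].
have sD : (size D <= f0)%N.
  by have := max_poly_roots (minpoly_neq0 hq) rD uD; rewrite qf0.
have count m : (forall a, (size [seq z <- t | z ^+ k == a] <= m)%N) ->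
    (size r <= m * size D)%N.
  move=> hm; rewrite -(size_map (fun x => res (x / y))).
  apply: (size_le_fibres (g := c)) => [z|a]; first by rewrite mem_undup.
  apply: leq_trans (hm (a / ub)); rewrite !size_filter.
  apply: sub_count => z /= /eqP <-.
  by rewrite /c mulfK.
have f00 : (0 < f0)%N by rewrite -ltnS -qf0; apply: minpoly_size_gt1 hq.
(* The chain [k f0 <= size r <= k * size D <= k f0] collapses. *)
have eD : size D = f0.
  apply/eqP; rewrite eqn_leq sD -(leq_pmul2l k0) /=.
  apply: leq_trans m_ge (count k _) => a; exact: exp_fibre_le.
have er : size r = (k * f0)%N.
  apply/eqP; rewrite eqn_leq m_ge andbT -eD; apply: count => a.
  exact: exp_fibre_le.
(* [D] lists as many distinct roots of [q] as its degree. *)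
have sepq : separable_poly q.
  have uD' : uniq_roots D by rewrite uniq_rootsE.
  have sz : size q = (size D).+1 by rewrite eD.
  rewrite (all_roots_prod_XsubC sz rD uD').
  by have := minpoly_monic hq; rewrite monicE => /eqP ->; rewrite scale1r separable_prod_XsubC.
have ram_ge : (k <= ram_index w E E1)%N.
  by have := ram_le hE hE1 fin incE1 inc; rewrite card_ord.
have deg_ge : (f0 <= residue_degree w E E1)%N.
  by have := indep_le_degree hR finR powR1 iu; rewrite card_ord.
have fle := fundamental_inequality w hE hE1 fin.
have degr : degree E E1 = (k * f0)%N by rewrite -er (conj_size hE hr).
rewrite degr in fle.
have ramk : ram_index w E E1 = k.
  apply/eqP; rewrite eqn_leq ram_ge andbT -(leq_pmul2r f00).
  by apply: leq_trans fle; rewrite leq_mul2l deg_ge orbT.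
have degf : (residue_degree w E E1 <= f0)%N.
  by rewrite -(leq_pmul2l k0) -{1}ramk.
split.
  (* If [p] divided [k], the smaller fibres would give [k f0 <= (k / p) f0]. *)
  apply: coprime_char_exponentP => p pk; rewrite ramk; apply/negP => pdk.
  have := count (k %/ p)%N (fun a => exp_fibre_le_pchar a pk k0 pdk ut).
  rewrite er eD leq_pmul2r // leqNgt ltn_Pdiv //.
  exact: prime_gt1 (pcharf_prime pk).
have <- : adjoin (rs E) ub = rs E1.
  apply/esym; apply: (degree_eq hR (adjoin_subfield _ _) (@sub_adjoin _ _ _) _ finR).
    by apply: adjoin_min => //; apply: residues_sub.
  by rewrite -/(deg _ _) (degE hR hq).
by apply: sep_adjoin => //; exists q.
Qed.

End TameCriterion.

(** * Induction along complete distinguished chains *)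

Section Chains.
Variables (L : closedFieldType) (G : ogroupType) (w : valuation L G).
Variables (F : set L) (hF : is_subfield F) (alg : forall x, algebraic_over F x).
Hypothesis hw : forall s : {rmorphism L -> L}, fixes F s ->
  forall x, w (s x) = w x.
Local Notation rs E := (@residues _ _ w E).

Lemma tame_sub E E' : E' `<=` E -> tame w F E -> tame w F E'.
Proof. by move=> sE tE E1 h1 sF s1 fin; apply: tE => // x /s1/sE. Qed.

(** [F(s 1)] lies in [F(s 0)], so separability and tameness pass to the shifted chain. The strict
    decrease of the [delta] values is kept for counting them. *)
Lemma tame_chain n (s : nat -> L) :
  separable_over F (s 0%N) -> tame w F (adjoin F (s 0%N)) ->
  complete_distinguished_chain w F (s 0%N) n s ->
  [/\ forall i, (i < n)%N -> delta w F (s i) = omega w F (s i),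
      forall i, (i < n)%N -> adjoin F (s i.+1) `<` adjoin F (s i),
      krasner_set w F (s 0%N) = [set delta w F (s i) | i in `I_n]
    & forall i j, (i < j < n)%N -> delta w F (s j) < delta w F (s i)].
Proof.
elim: n s => [|n IH] s ss ts [_ hdp Fn].
  (* For [n = 0] the element lies in [F] and is its own only conjugate, so both sets are empty. *)
  split=> // [|i j]; last by rewrite ltn0 andbF.
  rewrite II0 image_set0; apply/seteqP; split=> // x.
  by case/(krasner_setP w hF alg) => t [ht []]; apply: ht.
have dp := hdp 0%N isT.
have [kb maxb _ sub] := tame_step hF alg hw ss dp ts.
have [kE klt] := tame_krasner_step hF alg hw ss dp ts.
have d0 : delta w F (s 0%N) = w (s 0%N - s 1%N) := dist_pair_delta dp.
have s1 : separable_over F (s 1%N).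
  by apply: (sep_adjoin hF ss); apply: (properW sub); apply: mem_adjoin.
have t1 : tame w F (adjoin F (s 1%N)) := tame_sub (properW sub) ts.
have [] := IH (s \o S) s1 t1.
  by split=> // i ltin; apply: hdp.
move=> /= IH1 IH2 IH3 IH4; split.
- case=> [_|i]; last by rewrite ltnS; apply: IH1.
  by rewrite d0; apply/esym; apply: set_maxE.
- by case=> [_|i] //; rewrite ltnS; apply: IH2.
- rewrite kE IH3; apply/seteqP; split=> [x [->|[i /= ltin <-]]|x [[|i] /= ltin <-]].
  + by exists 0%N.
  + by exists i.+1.
  + by left.
  + by right; exists i.
case=> [|i] [|j] //=; last exact: IH4.
by rewrite ltnS d0 => ltjn; apply: klt; rewrite IH3; exists j.
Qed.

Lemma tame_chain_card n (s : nat -> L) :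
  separable_over F (s 0%N) -> tame w F (adjoin F (s 0%N)) ->
  complete_distinguished_chain w F (s 0%N) n s ->
  krasner_set w F (s 0%N) #= `I_n.
Proof.
move=> ss ts ch; have [_ _ -> dec] := tame_chain ss ts ch.
apply: inj_card_eq => i j; rewrite !in_setE /= => ltin ltjn e.
case: (ltngtP i j) => // lt.
  by have := dec i j; rewrite lt ltjn e ltxx => /(_ isT).
by have := dec j i; rewrite lt ltin e ltxx => /(_ isT).
Qed.

(** Powers of separable elements are separable, so the exponents of the members can be multiplied
    together. *)
Lemma sep_exponent_seq n (s : nat -> L) :
  exists2 q, [pchar L].-nat q &
    forall i, (i < n)%N -> separable_over F (s i ^+ q).
Proof.
elim: n => [|n [q hq sq]]; first by exists 1%N.
have [q' hq' sq'] := sep_exponent hF (alg (s n)).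
exists (q * q')%N; first by rewrite pnatM hq.
move=> i; rewrite ltnS leq_eqVlt => /orP[/eqP->|/sq si].
  by rewrite mulnC exprM; apply: sep_pow.
by rewrite exprM; apply: sep_pow.
Qed.

(* A member of the chain may be inseparable, so the tower is built from the
   [q]-th powers, [q] a power of the characteristic exponent of [F]: raising to
   the [q]-th power is an injective ring endomorphism that multiplies all
   distances by [q], hence preserves the hypotheses. *)
Lemma tame_tower n (s : nat -> L) q : [pchar L].-nat q ->
  (forall i, (i <= n)%N -> separable_over F (s i ^+ q)) ->
  (forall i, (i < n)%N -> s i != s i.+1) ->
  (forall i, (i < n)%N ->
     forall x, krasner_set w F (s i) x -> x <= w (s i - s i.+1)) ->
  F (s n) ->
  exists E, [/\ is_subfield E, F `<=` E, finite_ext F E, E (s 0%N ^+ q) &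
    coprime (ram_index w F E) (char_exponent (residue_field w)) /\
    separable_ext (rs F) (rs E)].
Proof.
move=> hq sq ns mx Fn.
(* The chain ends in [F], so the tower grows from index [n] downwards; [j] counts the steps made. *)
suff : forall j, (j <= n)%N ->
  exists E, [/\ is_subfield E, F `<=` E, finite_ext F E, E (s (n - j)%N ^+ q) &
    coprime (ram_index w F E) (char_exponent (residue_field w)) /\
    separable_ext (rs F) (rs E)].
  by move=> /(_ n (leqnn n)); rewrite subnn.
have q0 : (0 < q)%N by case/andP: hq.
elim=> [_|j IH ltjn].
  have finF : finite_ext F F.
    by apply: (finite_sub hF (adjoin_finite hF (alg 0))); apply: sub_adjoin.
  exists F; split=> //; first by rewrite subn0; apply: subfX.
  split.
    have tF : coset_transversal (value_group w F) (value_group w F) (fun _ : 'I_1 => 0).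
      have hV := vg_subgroup w hF; split=> [_|i k _|g Fg].
      - by case: hV.
      - by rewrite (ord1 i) (ord1 k).
      - by exists ord0; rewrite subr0.
    by rewrite (ramE hF tF) card_ord coprime1n.
  by move=> x Fx; apply: sep_base => //; apply: residues_subfield.
have [E [hE sE fin Ec [cE sepE]]] := IH (ltnW ltjn).
set i := (n - j.+1)%N; have iE : (n - j)%N = i.+1 by rewrite /i subnSK.
rewrite iE in Ec; have ltin : (i < n)%N by rewrite /i ltn_subrL (leq_trans _ ltjn).
have powB (x y : L) : (x - y) ^+ q = x ^+ q - y ^+ q.
  by rewrite exprDn_pchar // exprNn_pchar.
set y := s i ^+ q - s i.+1 ^+ q.
have yE : y = (s i - s i.+1) ^+ q by rewrite powB.
have y0 : y != 0 by rewrite yE expf_neq0 // subr_eq0 ns.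
have algE x : algebraic_over E x by apply: (algebraic_over_sub sE).
have hwE (t : {rmorphism L -> L}) : fixes E t -> forall x, w (t x) = w x.
  by move=> ht; apply: hw; apply: fixes_sub ht.
have sy : separable_over E y.
  have st : separable_over E (s i ^+ q).
    by apply: (sep_sub hF hE sE); apply: sq; apply: ltnW.
  apply: (sep_adjoin hE st); apply: (subfB (adjoin_subfield E (s i ^+ q))).
    exact: mem_adjoin.
  exact: sub_adjoin.
set E1 := adjoin E y; have hE1 : is_subfield E1 by apply: adjoin_subfield.
have sE1 : E `<=` E1 by apply: sub_adjoin.
have far (t : {rmorphism L -> L}) : fixes E t -> t y = y \/ w (t y - y) <= w y.
  move=> ht; have htF := fixes_sub sE ht.
  (* [t] fixes [s i.+1 ^+ q], which lies in [E], so only [s i] contributes. *)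
  have tyE : t y - y = (t (s i) - s i) ^+ q.
    by rewrite powB /y rmorphB (ht _ Ec) rmorphXn; ring.
  have [ti|ti] := pselect (t (s i) = s i).
    by left; apply/eqP; rewrite -subr_eq0 tyE ti subrr expr0n eqn0Ngt q0.
  right; rewrite tyE yE leNgt w_ltXE // -leNgt wBC; apply: mx => //.
  by apply/(krasner_setP w hF alg); exists t.
have [cE1 sepE1] := separated_conjugates_tame hE algE hwE sy y0 far.
have fin1 : finite_ext F E1.
  have [e he] := finite_extP hF fin.
  have [f hf] := finite_extP hE (adjoin_finite hE (algE y)).
  exact: (fbasis_finite (fbasis_tower hE hE1 sE sE1 he hf)).
exists E1; split=> //.
- by move=> x /sE/sE1.
- rewrite -[s i ^+ q](subrK (s i.+1 ^+ q)); apply: (subfD hE1); last exact: sE1.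
  exact: mem_adjoin.
split.
  by rewrite (ram_tower w hF hE hE1 sE sE1 fin1) coprimeMl cE.
apply: (sep_trans (residues_subfield w hF) (residues_subfield w hE)
  (residues_subfield w hE1) _ _ _ sepE sepE1).
- exact: residues_sub.
- exact: residues_sub.
- exact: residues_finite.
Qed.

(** Separability puts [a] in [F(a^q)], so [F(a)] lies in [E]. The ramification index of a
    subextension divides that of [E], and its residues lie among those of [E]. *)
Lemma tame_of_extension a q E : [pchar L].-nat q -> separable_over F a ->
  is_subfield E -> F `<=` E -> finite_ext F E -> E (a ^+ q) ->
  coprime (ram_index w F E) (char_exponent (residue_field w)) ->
  separable_ext (rs F) (rs E) ->
  defectless w F (adjoin F a) -> tame w F (adjoin F a).
Proof.
move=> hq sa hE sE fin Eaq cE sepE da E' hE' sF sE' fin'.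
have hFa := adjoin_subfield F a.
have sFa : F `<=` adjoin F a := @sub_adjoin _ _ _.
have finFa : finite_ext F (adjoin F a) by apply: adjoin_finite.
have sE1 : E' `<=` E.
  move=> x /sE'; apply: adjoin_min => //.
  by apply: adjoin_min (sep_mem_adjoin_pow hF hq sa).
split.
- by move: cE; rewrite (ram_tower w hF hE' hE sF sE1 fin) coprimeMl => /andP[].
- by move=> x /(residues_sub sE1)/sepE.
- by have [] := defectless_tower hF hE' hFa sF sE' finFa da.
Qed.

End Chains.

Theorem theorem4p1
    (K : fieldType) (GK : ogroupType) (v : valuation K GK)
    (hens : henselian v) (nontriv : nontrivial v)
    (L : closedFieldType) (iota : {rmorphism K -> L})
    (closure : is_algebraic_closure iota)
    (G : ogroupType) (w : valuation L G) (ext : extends iota v w)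
    (a : L) (a_sep : separable_over (range iota) a) (a_notin : ~ range iota a)
    (n : nat) (s : nat -> L)
    (chain : defectless w (range iota) (adjoin (range iota) a) ->
       complete_distinguished_chain w (range iota) a n s) :
  (tame w (range iota) (adjoin (range iota) a) <->
     defectless w (range iota) (adjoin (range iota) a) /\
     (forall i, (i < n)%N ->
        delta w (range iota) (s i) = omega w (range iota) (s i))) /\
  (tame w (range iota) (adjoin (range iota) a) ->
     [/\ forall i, (i < n)%N ->
           adjoin (range iota) (s i.+1) `<` adjoin (range iota) (s i),
         krasner_set w (range iota) a =
           [set delta w (range iota) (s i) | i in `I_n]
       & krasner_set w (range iota) a #= `I_(depth w (range iota) a)]).
Proof.
set F := range iota in a_sep a_notin chain *.
have hF : is_subfield F := range_subfield iota.
have alg : forall x, algebraic_over F x := range_algebraic closure.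
have hw := henselian_fixes hens closure ext.
have hFa := adjoin_subfield F a; have sFa : F `<=` adjoin F a := @sub_adjoin _ _ _.
have finFa : finite_ext F (adjoin F a) by apply: adjoin_finite.
have tame_defectless : tame w F (adjoin F a) -> defectless w F (adjoin F a).
  by move=> /(_ _ hFa sFa (@subset_refl _ _) finFa)[].
(* Stated for every chain, because [depth] may select one other than [s]; its length is then pinned
   down by the size of the Krasner set. *)
have chain_eq : tame w F (adjoin F a) -> forall m t,
    complete_distinguished_chain w F a m t ->
  [/\ forall i, (i < m)%N -> delta w F (t i) = omega w F (t i),
      forall i, (i < m)%N -> adjoin F (t i.+1) `<` adjoin F (t i),
      krasner_set w F a = [set delta w F (t i) | i in `I_m]
    & krasner_set w F a #= `I_m].
  move=> ta m t ct; have [t0 _ _] := ct; rewrite -t0 in a_sep ta ct *.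
  have card := tame_chain_card hF alg hw a_sep ta ct.
  by have [h1 h2 h3 _] := tame_chain hF alg hw a_sep ta ct.
split; last first.
  move=> ta; have ct := chain (tame_defectless ta).
  have [_ h2 h3 h4] := chain_eq ta n s ct; split=> //.
  rewrite /depth; case: xgetP => [m _ [t ct']|/(_ n)[]]; last by exists s.
  by have [] := chain_eq ta m t ct'.
split=> [ta|[da eq]].
  have da := tame_defectless ta; split=> //.
  by have [] := chain_eq ta n s (chain da).
have [s0 hdp Fn] := chain da.
(* The bound is strict, so [n.+1] includes the last member [s n]. *)
have [q hq sq] := sep_exponent_seq hF alg n.+1 s.
have neq i : (i < n)%N -> s i != s i.+1.
  by move=> /hdp[+ _ _]; apply: contraTneq => ->; rewrite ltnn.
have mx i : (i < n)%N -> forall x, krasner_set w F (s i) x -> x <= w (s i - s i.+1).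
  move=> ltin x kx; have dE := dist_pair_delta (hdp i ltin).
  have [g gE] : exists g, w (s i - s i.+1) = Some g.
    by apply: wSome; rewrite subr_eq0 neq.
  (* [delta] is finite because [s i] and [s i.+1] differ, so [omega] is not the default infinity. *)
  have /set_max_Some[_ hm] : set_max (krasner_set w F (s i)) = Some g.
    by rewrite -gE -dE (eq i ltin).
  by rewrite gE; apply: hm.
have [E [hE sE fin Ea [cE sepE]]] := tame_tower hF alg hw hq sq neq mx Fn.
rewrite s0 in Ea.
exact: (tame_of_extension hF alg hq a_sep hE sE fin Ea cE sepE da).
Qed.
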